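(* Consider $f=\frac1n\sum_{i=1}^n f_i:\mathbb{R}^d\to\mathbb{R}$ with $f^\star=\inf f>-\infty$. Let $f$ be $L$-smooth and each $f_i$ be $L_i$-smooth; set $\widetilde L=\sqrt{\frac1n\sum_i L_i^2}$ and $F_0=f(x_0)-f^\star$. Then there are absolute constants $c,C>0$ such that for $\eta=c\delta$ there exists a stepsize $\gamma\le C\delta/\widetilde L$ such that after at most $$T=\mathcal O\left(\frac{LF_0\sigma^2}{n\epsilon^2}+\frac{LF_0\sigma}{\delta^2\epsilon^{3/2}}+\frac{\widetilde LF_0}{\delta\epsilon}\right)$$ iterations of Algorithm EControl (described in the context) it holds $\mathbb{E}\|\nabla f(x_{\mathrm{out}})\|^2\le\epsilon$, where $x_{\mathrm{out}}$ is chosen uniformly at random from $\{x_0,\dots,x_T\}$.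
   Context: $L$-smooth means $L$-Lipschitz gradient. Each client $i$ has a stochastic gradient oracle $g^i(x)$ with $\mathbb{E}[g^i(x)]=\nabla f_i(x)$, $\mathbb{E}\|g^i(x)-\nabla f_i(x)\|^2\le\sigma^2$, fresh independent randomness at each call. $\mathcal{C}_\delta$ ($0<\delta\le1$) is a possibly randomized map with $\mathbb{E}\|\mathcal{C}_\delta(x)-x\|^2\le(1-\delta)\|x\|^2$ for all $x$, independent randomness at each call. Algorithm EControl: input $x_0$, stepsize $\gamma>0$, parameter $\eta>0$, $e_0^i=0$, $h_0^i=g^i(x_0)$, $h_0=\frac1n\sum_i h_0^i$. For $t=0,1,2,\dots$: each client $i$ computes $g_t^i=g^i(x_t)$, $\Delta_t^i=\mathcal{C}_\delta(\eta e_t^i+g_t^i-h_t^i)$, $e_{t+1}^i=e_t^i+g_t^i-h_t^i-\Delta_t^i$, $h_{t+1}^i=h_t^i+\Delta_t^i$, sends $\Delta_t^i$; the server sets $x_{t+1}=x_t-\gamma h_t-\frac\gamma n\sum_i\Delta_t^i$, $h_{t+1}=h_t+\frac1n\sum_i\Delta_t^i$. $\mathcal O(\cdot)$ hides an absolute constant. *)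

(* Defs.v *)
From HB Require Import structures.
From mathcomp Require Import all_boot all_order all_algebra.
From mathcomp Require Import all_classical all_reals all_analysis.
Set Implicit Arguments. Unset Strict Implicit. Unset Printing Implicit Defensive.
Import Order.TTheory GRing.Theory Num.Theory.
Import numFieldNormedType.Exports.
Local Open Scope classical_set_scope.
Local Open Scope ring_scope.

Section Defs.
Variable R : realType.

Definition sqn (d : nat) (v : 'rV[R]_d) : R := \sum_(j < d) (v 0 j) ^+ 2.
Definition enorm (d : nat) (v : 'rV[R]_d) : R := Num.sqrt (sqn v).

Definition grad (d : nat) (f : 'rV[R]_d -> R) (x : 'rV[R]_d) : 'rV[R]_d :=
  \row_(j < d) ('d f x : 'rV[R]_d -> R) (delta_mx 0 j).

Definition smooth (d : nat) (L : R) (f : 'rV[R]_d -> R) : Prop :=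
  (forall x, differentiable f x) /\
  (forall x y, enorm (grad f x - grad f y) <= L * enorm (x - y)).

Definition favg (d n : nat) (fi : 'I_n -> 'rV[R]_d -> R) (x : 'rV[R]_d) : R :=
  n%:R^-1 * \sum_(i < n) fi i x.

(* joint (Borel) measurability of a randomized map F : R^d x Xi -> R^d,
   R^d being identified with d.-tuple R (product sigma-algebra) *)
Definition jmeas (dX : measure_display) (X : measurableType dX) (d : nat)
  (F : 'rV[R]_d -> X -> 'rV[R]_d) : Prop :=
  forall j : 'I_d, measurable_fun setT
    (fun p : (d.-tuple R * X)%type => (F (\row_(k < d) tnth p.1 k) p.2) 0 j).

Definition stoch_oracle (dX : measure_display) (X : measurableType dX)
  (mu : probability X R) (d n : nat) (fi : 'I_n -> 'rV[R]_d -> R)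
  (g : 'I_n -> 'rV[R]_d -> X -> 'rV[R]_d) (sigma : R) : Prop :=
  (forall i, jmeas (g i)) /\
  (forall i x,
     (forall j : 'I_d,
        mu.-integrable setT (fun xi => ((g i x xi) 0 j)%:E) /\
        (\int[mu]_xi ((g i x xi) 0 j)%:E = ((grad (fi i) x) 0 j)%:E)%E) /\
     (\int[mu]_xi (sqn (g i x xi - grad (fi i) x))%:E <= (sigma ^+ 2)%:E)%E).

Definition compressor (dX : measure_display) (X : measurableType dX)
  (nu : probability X R) (d : nat) (delta : R)
  (C : 'rV[R]_d -> X -> 'rV[R]_d) : Prop :=
  jmeas C /\
  (forall x, (\int[nu]_z (sqn (C x z - x))%:E <= ((1 - delta) * sqn x)%:E)%E).

(* mutual independence of all oracle noises xi t i (law mu) and all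
   compressor noises zeta t i (law nu): for every finite box of indices
   (t < N) and measurable sets (take setT to drop an index) the joint
   probability factorizes. *)
Definition iid_noise (dO : measure_display) (O : measurableType dO)
  (P : probability O R) (dX : measure_display) (X : measurableType dX)
  (mu : probability X R) (dY : measure_display) (Y : measurableType dY)
  (nu : probability Y R) (n : nat)
  (xi : nat -> 'I_n -> O -> X) (zeta : nat -> 'I_n -> O -> Y) : Prop :=
  (forall t i, measurable_fun setT (xi t i)) /\
  (forall t i, measurable_fun setT (zeta t i)) /\
  (forall (N : nat) (A : nat -> 'I_n -> set X) (B : nat -> 'I_n -> set Y),
     (forall t i, measurable (A t i)) -> (forall t i, measurable (B t i)) ->
     P [set w | forall t i, (t < N)%N -> A t i (xi t i w) /\ B t i (zeta t i w)]
     = (\prod_(t < N) \prod_(i < n) (mu (A t i) * nu (B t i)))%E).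

Record state (d n : nat) := St {
  sx : 'rV[R]_d;
  se : 'I_n -> 'rV[R]_d;
  sh : 'I_n -> 'rV[R]_d;
  shb : 'rV[R]_d
}.

Section Alg.
Variables (d n : nat) (X Y : Type).
Variables (g : 'I_n -> 'rV[R]_d -> X -> 'rV[R]_d) (C : 'rV[R]_d -> Y -> 'rV[R]_d).
Variables (x0 : 'rV[R]_d) (gamma eta : R).

Definition econtrol_init (xi0 : 'I_n -> X) : state d n :=
  let h0 := fun i => g i x0 (xi0 i) in
  St x0 (fun _ => 0) h0 (n%:R^-1 *: \sum_(i < n) h0 i).

Definition econtrol_step (xit : 'I_n -> X) (zt : 'I_n -> Y) (s : state d n) :
  state d n :=
  let gt := fun i => g i (sx s) (xit i) in
  let D := fun i => C (eta *: se s i + gt i - sh s i) (zt i) in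
  St (sx s - gamma *: shb s - (gamma / n%:R) *: \sum_(i < n) D i)
     (fun i => se s i + gt i - sh s i - D i)
     (fun i => sh s i + D i)
     (shb s + n%:R^-1 *: \sum_(i < n) D i).

(* oracle call at iteration t uses noise xi t.+1; h_0 uses xi 0;
   compressor call at iteration t uses zeta t *)
Fixpoint econtrol_run (xi : nat -> 'I_n -> X) (zeta : nat -> 'I_n -> Y)
  (t : nat) : state d n :=
  match t with
  | 0 => econtrol_init (xi 0)
  | t'.+1 => econtrol_step (xi t) (zeta t') (econtrol_run xi zeta t')
  end.

Definition econtrol_x xi zeta t : 'rV[R]_d := sx (econtrol_run xi zeta t).
End Alg.

End Defs.

(* Main.v *)
Require Import Defs.
From HB Require Import structures.
From mathcomp Require Import all_boot all_order all_algebra.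
From mathcomp Require Import all_classical all_reals all_analysis.
From mathcomp Require Import measurable_realfun ring lra.
Import Order.TTheory GRing.Theory Num.Theory.
Import numFieldNormedType.Exports.
Local Open Scope classical_set_scope.
Local Open Scope ring_scope.

(** Write u = eta e + g - h for what a client compresses and r = u - C(u) for the
compression error. Then e^+ = (1 - eta) e + r and
u^+ = (1 + eta) r - eta^2 e + (g^+ - g), while the virtual iterate x - gamma e (with e
averaged over the clients) performs an exact stochastic gradient step. Since
E|r|^2 <= (1 - delta) E|u|^2, the second moments of e and u obey a linear recursion driven
by the noise and by |x^+ - x|^2; adding suitable multiples of them to the descent
inequality along the virtual iterates makes it telescope, and the error left is
O(gamma^2 L^2 sigma^2 / delta^4). The step size balances the three remaining terms; the
gradient of f is also Ltil-Lipschitz, so L may be replaced by min(L, Ltil).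

Conditional expectations are handled by Tonelli's theorem: a noise variable is
independent of the sigma-algebra generated by the boxes in all the other noise variables. *)

(** * Independence and Tonelli's theorem *)

(** The parameter eta is what makes the coupled recursion stable. The errors decay at rate eta and
    are fed by 1/eta times the second moment of u; u contracts at a rate of order delta and, since e
    enters u^+ only through eta^2, is fed by e with a weight of order eta^4 / delta. With eta
    proportional to delta, the product of the two couplings and the product of the two decay rates
    are both of order delta^2; the constant 1/16 makes the former small enough for a common Lyapunov
    function.

    The memory h drops out of this recursion and u_0 is a difference of two oracle calls at x_0, so
    no bound on client dissimilarity appears. Averaging over clients gains its factor 1/n only in
    the virtual descent; the noise entering through u is bounded crudely, because it reaches the
    descent multiplied by gamma^3.

    The Lyapunov argument needs gamma L <= delta / 100, while the step size is tied to Ltil. The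
    given L is any Lipschitz constant and may exceed Ltil, hence the minimum. *)

Section indep.
Context {R : realType} {dO : measure_display} {O : measurableType dO}
  (P : probability O R) {dZ : measure_display} {Z : measurableType dZ}
  (rho : probability Z R) (G : set (set O)) (V : O -> Z).
Hypotheses (GI : setI_closed G) (GT : G setT) (Gm : G `<=` measurable)
  (mV : measurable_fun setT V).
Hypothesis indepGV : forall A D, G A -> measurable D ->
  P (A `&` V @^-1` D) = (P A * rho D)%E.

Let sO : measurableType _ := g_sigma_algebraType G.
Let idG : O -> sO := fun w => w.

Let smallG : <<s G >> `<=` (measurable : set (set O)).
Proof. exact: smallest_sub (@sigma_algebra_measurable _ O) Gm. Qed.

Lemma measurable_id_sub : measurable_fun setT idG.
Proof. by move=> _ A mA; rewrite setTI; exact: smallG. Qed.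

(** Both sides are finite measures in [A], a restriction and a rescaling of [P], and they agree on
    the pi-system [G], hence on the sigma-algebra that it generates. *)
Let indep_sigma A D : <<s G >> A -> measurable D ->
  P (A `&` V @^-1` D) = (P A * rho D)%E.
Proof.
move=> sA mD.
have mVD : measurable (V @^-1` D) by rewrite -[X in measurable X]setTI; exact: mV.
have rD0 : 0 <= fine (rho D) by rewrite fine_ge0.
pose m1 := mrestr P mVD.
pose m2 := mscale (NngNum rD0) P.
have E : m1 A = m2 A.
  apply: (g_sigma_algebra_measure_unique G Gm (fun=> setT)) => //.
  - by rewrite bigcup_const.
  - move=> B GB; rewrite /m1 /m2 /mrestr /mscale /= [LHS]indepGV//.
    by rewrite muleC; congr (_ * _)%E; rewrite fineK// fin_num_measure.
  - move=> _; apply: (@le_lt_trans _ _ 1%E); last exact: ltry.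
    by apply: probability_le1; exact: measurableI.
move: E; rewrite /m1 /m2 /mrestr /mscale /= => ->.
by rewrite muleC; congr (_ * _)%E; rewrite fineK// fin_num_measure.
Qed.

(** The law of (w, V w) on [sO * Z] is a product measure, which is checked on rectangles. Putting
    the smaller sigma-algebra on [O] itself lets Tonelli play the part of conditioning on [G]. *)
Lemma ge0_integral_indep (F : sO * Z -> \bar R) :
  measurable_fun setT F -> (forall p, 0 <= F p)%E ->
  (\int[P]_w F (w, V w) = \int[P]_w \int[rho]_z F (w, z))%E.
Proof.
move=> mF F0.
pose idM : {mfun O >-> sO} :=
  HB.pack idG (isMeasurableFun.Build _ _ _ _ _ measurable_id_sub).
have mpair : measurable_fun setT (fun w => (idG w, V w)).
  by apply: measurable_fun_pair => //; exact: measurable_id_sub.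
pose pM : {mfun O >-> (sO * Z)%type} :=
  HB.pack (fun w => (idG w, V w)) (isMeasurableFun.Build _ _ _ _ _ mpair).
have E X : measurable X -> (distribution P idM \x rho)%E X = distribution P pM X.
  apply: product_measure_unique => A B mA mB.
  by rewrite -indep_sigma.
transitivity (\int[distribution P pM]_p F p)%E.
  by rewrite ge0_integral_distribution.
transitivity (\int[distribution P idM \x rho]_p F p)%E.
  by apply: eq_measure_integral => A mA _; exact: (esym (E _ mA)).
rewrite fubini_tonelli1// ge0_integral_distribution//.
- exact: measurable_fun_fubini_tonelli_F.
- by move=> w; apply: integral_ge0.
Qed.
End indep.

(** * Integrating out a single noise variable *)

Section noise.
Context {R : realType} {dO : measure_display} {O : measurableType dO}
  (P : probability O R) {dX : measure_display} {X : measurableType dX}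
  (mu : probability X R) {dY : measure_display} {Y : measurableType dY}
  (nu : probability Y R) {n : nat}
  (xi : nat -> 'I_n -> O -> X) (zeta : nat -> 'I_n -> O -> Y).

(** Lets a result about oracle noise be reused for compressor noise. *)
Lemma iid_noiseC : iid_noise P mu nu xi zeta -> iid_noise P nu mu zeta xi.
Proof.
move=> [mxi [mzeta H]]; split=> //; split=> // N A B mA mB.
under eq_bigr do under eq_bigr do rewrite muleC.
rewrite -(H N B A)//; congr (P _); apply/seteqP.
by split=> w /= Hw t i /(Hw t i)[].
Qed.

(** Constraining one more noise variable changes a single factor of a box probability; this is the
    multiplicativity that independence asks for. *)
Lemma prod_update (F F' : nat -> 'I_n -> \bar R) (c : \bar R) (M t0 : nat)
    (i0 : 'I_n) : (t0 < M)%N ->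
  (forall t i, (t, i) != (t0, i0) -> F t i = F' t i) ->
  F t0 i0 = (F' t0 i0 * c)%E ->
  (\prod_(t < M) \prod_(i < n) F t i
   = (\prod_(t < M) \prod_(i < n) F' t i) * c)%E.
Proof.
move=> tM FF' F0; rewrite (bigD1 (Ordinal tM))//= [in RHS](bigD1 (Ordinal tM))//=.
rewrite (bigD1 i0)//= [in RHS](bigD1 i0)//= F0.
rewrite (eq_bigr (F' t0)); last first.
  by move=> i ii0; rewrite FF'// xpair_eqE negb_and ii0 orbT.
rewrite [X in (_ * X)%E = _](eq_bigr
    (fun t : 'I_M => \prod_(i < n) F' t i)%E); last first.
  move=> t tt0; apply: eq_bigr => i _; rewrite FF'// xpair_eqE negb_and.
  by rewrite -(inj_eq val_inj)/= in tt0; rewrite tt0.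
by rewrite -!muleA; congr (_ * _)%E; rewrite [RHS]muleA muleC.
Qed.

Definition box (N : nat) (A : nat -> 'I_n -> set X) (B : nat -> 'I_n -> set Y) :
  set O := [set w | forall t i, (t < N)%N -> A t i (xi t i w) /\ B t i (zeta t i w)].

(** Padding with [setT] brings boxes to a common horizon, where they can be intersected side by
    side. *)
Definition cut {Z : Type} (N : nat) (A : nat -> 'I_n -> set Z) :=
  fun t i => if (t < N)%N then A t i else setT.

Lemma box_cut N M A B : (N <= M)%N -> box N A B = box M (cut N A) (cut N B).
Proof.
move=> NM; apply/seteqP; split=> w /= Hw t i; rewrite /cut.
  by case: ifPn => // tN _; exact: Hw.
by move=> tN; have := Hw t i (leq_trans tN NM); rewrite /cut tN.
Qed.

Definition boxes_off (t0 : nat) (i0 : 'I_n) : set (set O) :=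
  [set E | exists N A B, [/\ forall t i, measurable (A t i),
    forall t i, measurable (B t i), A t0 i0 = setT & E = box N A B]].

Hypothesis Hiid : iid_noise P mu nu xi zeta.
Let mxi : forall t i, measurable_fun setT (xi t i) := proj1 Hiid.
Let mzeta : forall t i, measurable_fun setT (zeta t i) := proj1 (proj2 Hiid).

Let mcut {d} {Z : measurableType d} N (A : nat -> 'I_n -> set Z) :
  (forall t i, measurable (A t i)) -> forall t i, measurable (cut N A t i).
Proof. by move=> mA t i; rewrite /cut; case: ifP. Qed.

Let mbox N A B : (forall t i, measurable (A t i)) ->
  (forall t i, measurable (B t i)) -> measurable (box N A B).
Proof.
move=> mA mB.
rewrite (_ : box N A B = \bigcap_(t in [set t | (t < N)%N])
   \bigcap_(i in [set: 'I_n]) ((xi t i @^-1` A t i) `&` (zeta t i @^-1` B t i))).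
  apply: fin_bigcap_measurable; first exact: finite_II.
  move=> t _; apply: fin_bigcap_measurable; first exact: finite_finset.
  move=> i _; apply: measurableI; rewrite -[X in measurable X]setTI;
    [exact: mxi|exact: mzeta].
apply/seteqP; split=> w /=; first by move=> Hw t tN i _; exact: Hw.
by move=> Hw t i tN; exact: Hw t tN i I.
Qed.

(** The sigma-algebra is kept abstract: later arguments only use that it sees every other noise
    variable and that [xi t0 i0] can be integrated out against it. *)
Lemma xi_tonelli t0 i0 : exists G : set (set O),
  [/\ forall t i, (t, i) != (t0, i0) ->
        measurable_fun [set: g_sigma_algebraType G] (xi t i),
      forall t i, measurable_fun [set: g_sigma_algebraType G] (zeta t i) &
      forall F : (g_sigma_algebraType G * X)%type -> \bar R,
        measurable_fun setT F -> (forall p, 0 <= F p)%E ->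
        (\int[P]_w F (w, xi t0 i0 w) = \int[P]_w \int[mu]_x F (w, x))%E].
Proof.
exists (boxes_off t0 i0); split.
- move=> t i ti _ D mD; rewrite setTI; apply: sub_sigma_algebra.
  exists t.+1, (fun s j => if (s, j) == (t, i) then D else setT), (fun _ _ => setT).
  split => //.
  + by move=> s j; case: ifP.
  + by rewrite eq_sym (negbTE ti).
  apply/seteqP; split=> w /=.
    by move=> Dw s j _; split=> //; case: ifPn => // /eqP[-> ->].
  by move=> /(_ t i (ltnSn t)); rewrite eqxx => -[].
- move=> t i _ D mD; rewrite setTI; apply: sub_sigma_algebra.
  exists t.+1, (fun _ _ => setT), (fun s j => if (s, j) == (t, i) then D else setT).
  split => //.
  + by move=> s j; case: ifP.
  apply/seteqP; split=> w /=.
    by move=> Dw s j _; split=> //; case: ifPn => // /eqP[-> ->].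
  by move=> /(_ t i (ltnSn t)); rewrite eqxx => -[].
- apply: ge0_integral_indep => //.
  + move=> _ _ [N1 [A1 [B1 [mA1 mB1 A10 ->]]]] [N2 [A2 [B2 [mA2 mB2 A20 ->]]]].
    exists (maxn N1 N2), (fun t i => cut N1 A1 t i `&` cut N2 A2 t i),
      (fun t i => cut N1 B1 t i `&` cut N2 B2 t i); split.
    * by move=> t i; apply: measurableI; exact: mcut.
    * by move=> t i; apply: measurableI; exact: mcut.
    * by rewrite /cut A10 A20; do 2 case: ifP => _; rewrite setTI.
    rewrite (box_cut _ _ A1 B1 (leq_maxl N1 N2)) (box_cut _ _ A2 B2 (leq_maxr N1 N2)).
    apply/seteqP; split=> w /=.
      by move=> [H1 H2] t i tM; have [] := H1 t i tM; have [] := H2 t i tM.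
    by move=> Hw; split=> t i tM; have [[] ? ? []] := Hw t i tM.
  + exists 0, (fun _ _ => setT), (fun _ _ => setT); split=> //.
    by apply/seteqP; split.
  + by move=> _ [N [A [B [mA mB _ ->]]]]; exact: mbox.
  move=> _ D [N [A [B [mA mB A0 ->]]]] mD.
  (* The horizon must exceed [t0] for the constraint [D] on [xi t0 i0] to be one of the sides of the
     box. *)
  rewrite (box_cut _ _ A B (leq_maxl N t0.+1)).
  set M := maxn N t0.+1.
  have tM : (t0 < M)%N by rewrite leq_max leqnn orbT.
  have cA0 : cut N A t0 i0 = setT by rewrite /cut A0; case: ifP.
  pose A' t i := if (t, i) == (t0, i0) then D else cut N A t i.
  rewrite (_ : _ `&` _ = box M A' (cut N B)); last first.
    apply/seteqP; split=> w /=.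
      move=> [Hw Dw] t i tN; have [? ?] := Hw t i tN; split=> //.
      by rewrite /A'; case: ifP => // /eqP[-> ->].
    move=> Hw; split; last by have [] := Hw t0 i0 tM; rewrite /A' eqxx.
    move=> t i tN; have [] := Hw t i tN; rewrite /A'; case: ifP => // /eqP[-> ->].
    by rewrite cA0.
  have [_ [_ H]] := Hiid.
  rewrite /box !H; [|try exact: mcut..]; last first.
    by move=> t i; rewrite /A'; case: ifP => // _; exact: mcut.
  apply: (prod_update (fun t i => mu (A' t i) * nu (cut N B t i))%E
    (fun t i => mu (cut N A t i) * nu (cut N B t i))%E (mu D) M t0 i0) => //.
    by move=> t i /negbTE ti; rewrite /A' ti.
  by rewrite /A' eqxx cA0 probability_setT mul1e muleC.
Qed.

End noise.

(** * Measurability along the algorithm *)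

Section measurable_vectors.
Context {R : realType} {d : nat}.

(** Coordinatewise, to match [jmeas], where row vectors are identified with tuples. *)
Definition mvec {dT} {T : measurableType dT} (V : T -> 'rV[R]_d) : Prop :=
  forall j, measurable_fun setT (fun w => V w 0 j).

Section closure.
Context {dT} {T : measurableType dT}.
Implicit Types V W : T -> 'rV[R]_d.

Lemma mvec_cst (v : 'rV[R]_d) : mvec (fun _ : T => v).
Proof. by move=> j; exact: measurable_cst. Qed.

Lemma mvecD V W : mvec V -> mvec W -> mvec (fun w => V w + W w).
Proof.
by move=> mV mW j; under eq_fun do rewrite mxE; exact: measurable_funD.
Qed.

Lemma mvecZ (a : R) V : mvec V -> mvec (fun w => a *: V w).
Proof.
by move=> mV j; under eq_fun do rewrite mxE; exact: measurable_funM.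
Qed.

Lemma mvecB V W : mvec V -> mvec W -> mvec (fun w => V w - W w).
Proof.
by move=> mV mW; under eq_fun do rewrite -scaleN1r; exact/mvecD/mvecZ.
Qed.

Lemma mvec_sum {I : Type} (r : seq I) (V : I -> T -> 'rV[R]_d) :
  (forall i, mvec (V i)) -> mvec (fun w => \sum_(i <- r) V i w).
Proof.
move=> mV j; under eq_fun do rewrite summxE.
by apply: measurable_sum => i; exact: mV.
Qed.

Lemma measurable_sqn V : mvec V -> measurable_fun setT (fun w => sqn (V w)).
Proof.
move=> mV; apply: measurable_sum => j; apply: measurable_funX; exact: mV.
Qed.

Lemma mvec_comp {dT'} {T' : measurableType dT'} (h : T' -> T) V :
  measurable_fun setT h -> mvec V -> mvec (fun w => V (h w)).
Proof. by move=> mh mV j; exact: (measurableT_comp (mV j) mh). Qed.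

Lemma measurable_tuple_of_row V : mvec V ->
  measurable_fun setT (fun w => [tuple V w 0 k | k < d]).
Proof.
move=> mV; apply/measurable_fun_tnthP => k.
by rewrite /comp; under eq_fun do rewrite tnth_mktuple; exact: mV.
Qed.

End closure.

Lemma row_mktuple (v : 'rV[R]_d) : \row_(k < d) tnth [tuple v 0 k | k < d] k = v.
Proof. by apply/rowP => k; rewrite mxE tnth_mktuple. Qed.

Lemma mvec_jmeas {dX} {X : measurableType dX} (F : 'rV[R]_d -> X -> 'rV[R]_d)
    {dT} {T : measurableType dT} (V : T -> 'rV[R]_d) (h : T -> X) :
  jmeas F -> mvec V -> measurable_fun setT h -> mvec (fun w => F (V w) (h w)).
Proof.
move=> mF mV mh j.
have := measurableT_comp (mF j)
  (measurable_fun_pair (measurable_tuple_of_row _ mV) mh).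
by rewrite /comp/=; under eq_fun do rewrite row_mktuple.
Qed.

(* The gradient is the mean of the oracle, so its measurability in the point follows from
   that of parametrized integrals. *)
Lemma mvec_grad {dX} {X : measurableType dX} (mu : probability X R) (n : nat)
    (fi : 'I_n -> 'rV[R]_d -> R) (g : 'I_n -> 'rV[R]_d -> X -> 'rV[R]_d)
    (sigma : R) {dT} {T : measurableType dT} (V : T -> 'rV[R]_d) i :
  stoch_oracle mu fi g sigma -> mvec V -> mvec (fun w => grad (fi i) (V w)).
Proof.
move=> [mg Hg] mV j; apply/measurable_EFinP.
pose F (p : T * X) : \bar R := (g i (V p.1) p.2 0 j)%:E.
have mF : measurable_fun setT F.
  apply/measurable_EFinP; apply: (mvec_jmeas _ (V \o fst) snd) => //.
  exact: mvec_comp.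
rewrite (_ : _ \o _ = fun w => \int[mu]_x F (w, x))%E; last first.
  by apply/funext => w; have [/(_ j)[_ ->]] := Hg i (V w).
rewrite (_ : (fun w => _) = (fun w => \int[mu]_x F^\+ (w, x))
    \- (fun w => \int[mu]_x F^\- (w, x)))%E; last first.
  apply/funext => w; rewrite [LHS]integralE.
  under eq_integral do rewrite funepos_comp/=.
  by under [X in (_ - X)%E = _]eq_integral do rewrite funeneg_comp/=.
apply: emeasurable_funB.
- apply: measurable_fun_fubini_tonelli_F => //.
  exact: measurable_funepos.
- apply: measurable_fun_fubini_tonelli_F => //.
  exact: measurable_funeneg.
Qed.

End measurable_vectors.

Section run_measurable.
Context {R : realType} {d n : nat} {dX dY : measure_display}
  {X : measurableType dX} {Y : measurableType dY}
  (g : 'I_n -> 'rV[R]_d -> X -> 'rV[R]_d) (C : 'rV[R]_d -> Y -> 'rV[R]_d)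
  (x0 : 'rV[R]_d) (gamma eta : R) {dT : measure_display} {T : measurableType dT}
  (xi : nat -> 'I_n -> T -> X) (zeta : nat -> 'I_n -> T -> Y).
Hypotheses (mg : forall i, jmeas (g i)) (mC : jmeas C).

Definition run_at (t : nat) (w : T) : state R d n :=
  econtrol_run g C x0 gamma eta (fun k i => xi k i w) (fun k i => zeta k i w) t.

(** Only the noise consumed up to time [t] is assumed measurable, and [T] is arbitrary. Over a
    sub-sigma-algebra that ignores [xi t.+1 i], this expresses that the state at time [t] does not
    depend on that variable. *)
Lemma measurable_run t :
  (forall s i, (s <= t)%N -> measurable_fun setT (xi s i)) ->
  (forall s i, (s < t)%N -> measurable_fun setT (zeta s i)) ->
  [/\ mvec (fun w => sx (run_at t w)),
      forall i, mvec (fun w => se (run_at t w) i),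
      forall i, mvec (fun w => sh (run_at t w) i) &
      mvec (fun w => shb (run_at t w))].
Proof.
elim: t => [|t IH] mxi mzeta.
  have mh i : mvec (fun w => g i x0 (xi 0 i w)).
    by apply: (mvec_jmeas (g i) (fun=> x0)) => //; exact: mxi.
  split => [|i|i|] /=; [exact: mvec_cst|exact: mvec_cst|exact: mh|].
  by apply: mvecZ; exact: mvec_sum.
have [mx me mh mb] := IH (fun s i st => mxi s i (leqW st))
  (fun s i st => mzeta s i (ltnW st)).
have mG i : mvec (fun w => g i (sx (run_at t w)) (xi t.+1 i w)).
  by apply: mvec_jmeas => //; exact: mxi.
have mU i : mvec (fun w => eta *: se (run_at t w) i
    + g i (sx (run_at t w)) (xi t.+1 i w) - sh (run_at t w) i).
  by apply/mvecB => //; apply/mvecD => //; exact: mvecZ.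
have mD i : mvec (fun w => C (eta *: se (run_at t w) i
    + g i (sx (run_at t w)) (xi t.+1 i w) - sh (run_at t w) i) (zeta t i w)).
  by apply: mvec_jmeas => //; exact: mzeta.
split => [|i|i|] /=.
- apply: mvecB; last by apply: mvecZ; exact: mvec_sum.
  by apply: mvecB => //; exact: mvecZ.
- by apply: mvecB => //; apply: mvecB => //; exact: mvecD.
- exact: mvecD.
- by apply: mvecD => //; apply: mvecZ; exact: mvec_sum.
Qed.

End run_measurable.

(** * Euclidean vectors and second moments *)

Section euclidean.
Context {R : realType} {d : nat}.
Implicit Types u v w : 'rV[R]_d.

Definition dot u v : R := \sum_(j < d) u 0 j * v 0 j.

Lemma sqn_ge0 v : 0 <= sqn v.
Proof. by apply: sumr_ge0 => j _; exact: sqr_ge0. Qed.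

Lemma sqnZ (a : R) v : sqn (a *: v) = a ^+ 2 * sqn v.
Proof. by rewrite /sqn mulr_sumr; apply: eq_bigr => j _; rewrite mxE exprMn. Qed.

Lemma sqnN v : sqn (- v) = sqn v.
Proof. by rewrite -scaleN1r sqnZ sqrrN expr1n mul1r. Qed.

Lemma sqn0 : sqn (0 : 'rV[R]_d) = 0.
Proof. by rewrite /sqn big1// => j _; rewrite mxE expr0n. Qed.

Lemma sqnD u v : sqn (u + v) = sqn u + 2 * dot u v + sqn v.
Proof.
rewrite /sqn /dot mulr_sumr -!big_split; apply: eq_bigr => j _ /=.
by rewrite mxE sqrrD -mulr_natl.
Qed.

Lemma dotC u v : dot u v = dot v u.
Proof. by apply: eq_bigr => j _; rewrite mulrC. Qed.

Lemma dotDr u v w : dot u (v + w) = dot u v + dot u w.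
Proof.
by rewrite /dot -big_split; apply: eq_bigr => j _; rewrite mxE mulrDr.
Qed.

Lemma dotZr (a : R) u v : dot u (a *: v) = a * dot u v.
Proof.
by rewrite /dot mulr_sumr; apply: eq_bigr => j _; rewrite mxE mulrCA.
Qed.

Lemma dotDl u v w : dot (v + w) u = dot v u + dot w u.
Proof. by rewrite dotC dotDr !(dotC u). Qed.

Lemma dotNr u v : dot u (- v) = - dot u v.
Proof. by rewrite -scaleN1r dotZr mulN1r. Qed.

Lemma dotNl u v : dot (- u) v = - dot u v.
Proof. by rewrite dotC dotNr dotC. Qed.

Lemma dot0r u : dot u 0 = 0.
Proof. by rewrite /dot big1// => j _; rewrite mxE mulr0. Qed.

Lemma dot_sumr {I : Type} (r : seq I) u (F : I -> 'rV[R]_d) :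
  dot u (\sum_(i <- r) F i) = \sum_(i <- r) dot u (F i).
Proof.
by apply: (big_morph (dot u)) => [v w|]; [exact: dotDr|exact: dot0r].
Qed.

Lemma dotvv u : dot u u = sqn u.
Proof. by apply: eq_bigr => j _; rewrite expr2. Qed.

Lemma young_dot (s : R) u v : 0 < s -> 2 * dot u v <= s * sqn u + s^-1 * sqn v.
Proof.
move=> s0; rewrite /sqn /dot !mulr_sumr -big_split; apply: ler_sum => j _ /=.
rewrite -subr_ge0.
rewrite (_ : _ - _ = s * (u 0 j - s^-1 * v 0 j) ^+ 2); last by field; rewrite gt_eqF.
by rewrite mulr_ge0 ?sqr_ge0// ltW.
Qed.

Lemma young_sqn (s : R) u v : 0 < s ->
  sqn (u + v) <= (1 + s) * sqn u + (1 + s^-1) * sqn v.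
Proof. by move=> s0; rewrite sqnD; have := young_dot s u v s0; lra. Qed.

Lemma sqnD2 u v : sqn (u + v) <= 2 * sqn u + 2 * sqn v.
Proof. by have := young_sqn 1 u v ltr01; lra. Qed.

Lemma sqnB2 u v : sqn (u - v) <= 2 * sqn u + 2 * sqn v.
Proof. by have := sqnD2 u (- v); rewrite sqnN. Qed.

Lemma normr_dot u v : `|dot u v| <= sqn u + sqn v.
Proof.
have := young_dot 1 u v ltr01; have := young_dot 1 (- u) v ltr01.
rewrite dotNl sqnN invr1 !mul1r => H1 H2; rewrite ler_norml.
by have := sqn_ge0 u; have := sqn_ge0 v; lra.
Qed.

(** Jensen for the square, from the nonnegativity of the sum of squared deviations from the mean. *)
Lemma sqn_mean (n : nat) (v : 'I_n -> 'rV[R]_d) :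
  sqn (n%:R^-1 *: \sum_(i < n) v i) <= n%:R^-1 * \sum_(i < n) sqn (v i).
Proof.
have [n0|n0] := posnP n.
  have -> : n%:R = 0 :> R by rewrite n0.
  by rewrite invr0 scale0r sqn0 mul0r.
have n0' : 0 < (n%:R : R) by rewrite ltr0n.
set m := _ *: _.
have : 0 <= \sum_(i < n) sqn (v i - m) by apply: sumr_ge0 => i _; exact: sqn_ge0.
have E i : sqn (v i - m) = sqn (v i) - 2 * dot m (v i) + sqn m.
  by rewrite sqnD sqnN dotNr dotC mulrN.
under eq_bigr do rewrite E.
rewrite big_split/= sumr_const card_ord sumrB -mulr_sumr -dot_sumr.
have -> : \sum_(i < n) v i = n%:R *: m by rewrite scalerA divff ?gt_eqF// scale1r.
rewrite dotZr dotvv -mulr_natl => H.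
by rewrite ler_pdivlMl//; lra.
Qed.

End euclidean.

(** * Real-valued expectations and square-integrable vectors *)

Section expectation.
Context {R : realType} {dO : measure_display} {O : measurableType dO}
  (P : probability O R).
Implicit Types f h : O -> R.

Definition int1 f := P.-integrable setT (EFin \o f).
Definition Ex f : R := (\int[P]_w f w)%R.

Lemma int1D f h : int1 f -> int1 h -> int1 (fun w => f w + h w).
Proof. by move=> If Ih; exact: (integrableD _ If Ih). Qed.

Lemma int1Z (a : R) f : int1 f -> int1 (fun w => a * f w).
Proof. by move=> If; exact: (integrableZl _ a If). Qed.

Lemma int1B f h : int1 f -> int1 h -> int1 (fun w => f w - h w).
Proof. by move=> If Ih; exact: (integrableB _ If Ih). Qed.

Lemma int1_cst (a : R) : int1 (fun=> a).
Proof. exact: finite_measure_integrable_cst. Qed.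

Lemma int1_sum {I : Type} (r : seq I) (F : I -> O -> R) :
  (forall i, int1 (F i)) -> int1 (fun w => \sum_(i <- r) F i w).
Proof.
move=> IF; have := @integrable_sum _ _ _ P _ measurableT I r predT
  (fun i => EFin \o F i) (fun i _ => IF i).
by apply: eq_integrable => // w _ /=; rewrite sumEFin.
Qed.

Lemma ExD f h : int1 f -> int1 h -> Ex (fun w => f w + h w) = Ex f + Ex h.
Proof. by move=> If Ih; exact: RintegralD. Qed.

Lemma ExB f h : int1 f -> int1 h -> Ex (fun w => f w - h w) = Ex f - Ex h.
Proof. by move=> If Ih; exact: RintegralB. Qed.

Lemma ExZ (a : R) f : int1 f -> Ex (fun w => a * f w) = a * Ex f.
Proof. by move=> If; exact: RintegralZl. Qed.

Lemma Ex_cst (a : R) : Ex (fun=> a) = a.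
Proof.
rewrite /Ex Rintegral_cst//; have := probability_setT P.
by rewrite /= => ->; rewrite mulr1.
Qed.

Lemma Ex_sum {I : Type} (r : seq I) (F : I -> O -> R) :
  (forall i, int1 (F i)) ->
  Ex (fun w => \sum_(i <- r) F i w) = \sum_(i <- r) Ex (F i).
Proof.
move=> IF; elim: r => [|i r IH].
  by under [X in Ex X]eq_fun do rewrite big_nil; rewrite Ex_cst big_nil.
under [X in Ex X]eq_fun do rewrite big_cons.
by rewrite ExD// ?IH ?big_cons//; exact: int1_sum.
Qed.

Lemma Ex_le f h : int1 f -> int1 h -> (forall w, f w <= h w) -> Ex f <= Ex h.
Proof. by move=> If Ih fh; exact: le_Rintegral. Qed.

Lemma Ex_ge0 f : (forall w, 0 <= f w) -> 0 <= Ex f.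
Proof. by move=> f0; apply: Rintegral_ge0. Qed.

Lemma int1_le f h : measurable_fun setT f -> (forall w, `|f w| <= h w) ->
  int1 h -> int1 f.
Proof.
move=> mf fh; apply: le_integrable => //; first exact/measurable_EFinP.
by move=> w _ /=; rewrite lee_fin (le_trans (fh w))// ler_norm.
Qed.

Lemma int1_measurable f : int1 f -> measurable_fun setT f.
Proof. by move=> /measurable_int; rewrite -/(EFin \o f) => /measurable_EFinP. Qed.

Lemma int1_ge0P f : measurable_fun setT f -> (forall w, 0 <= f w) ->
  (\int[P]_w (f w)%:E < +oo)%E -> int1 f.
Proof.
move=> mf f0 foo; apply/integrableP; split; first exact/measurable_EFinP.
rewrite (eq_integral (fun w => (f w)%:E))// => w _ /=.
by rewrite ger0_norm.
Qed.

Lemma int1E f : int1 f -> (\int[P]_w (f w)%:E = (Ex f)%:E)%E.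
Proof.
by move=> If; rewrite /Ex /Rintegral fineK//; exact: integrable_fin_num.
Qed.

Lemma int1_integral_le f (a : R) : measurable_fun setT f -> (forall w, 0 <= f w) ->
  (\int[P]_w (f w)%:E <= a%:E)%E -> int1 f /\ Ex f <= a.
Proof.
move=> mf f0 fa.
have If : int1 f by apply: int1_ge0P => //; exact: le_lt_trans fa (ltry _).
by split=> //; rewrite -lee_fin -int1E.
Qed.

Section l2.
Context {d : nat}.
Implicit Types V W : O -> 'rV[R]_d.

Definition l2 V := mvec V /\ int1 (fun w => sqn (V w)).

Lemma l2_cst (v : 'rV[R]_d) : l2 (fun=> v).
Proof. by split; [exact: mvec_cst|exact: int1_cst]. Qed.

Lemma l2_le V f : mvec V -> int1 f -> (forall w, sqn (V w) <= f w) -> l2 V.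
Proof.
move=> mV If Vf; split=> //; apply: int1_le If; first exact: measurable_sqn.
by move=> w; rewrite ger0_norm ?sqn_ge0.
Qed.

Lemma l2Z (a : R) V : l2 V -> l2 (fun w => a *: V w).
Proof.
move=> [mV IV]; split; first exact: mvecZ.
by under eq_fun do rewrite sqnZ; exact: int1Z.
Qed.

Lemma l2D V W : l2 V -> l2 W -> l2 (fun w => V w + W w).
Proof.
move=> [mV IV] [mW IW].
apply: (l2_le _ (fun w => 2 * sqn (V w) + 2 * sqn (W w))); first exact: mvecD.
  by apply: int1D; exact: int1Z.
by move=> w; exact: sqnD2.
Qed.

Lemma l2B V W : l2 V -> l2 W -> l2 (fun w => V w - W w).
Proof.
by move=> lV lW; under eq_fun do rewrite -scaleN1r; exact/l2D/l2Z.
Qed.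

Lemma l2_sum {I : Type} (r : seq I) (V : I -> O -> 'rV[R]_d) :
  (forall i, l2 (V i)) -> l2 (fun w => \sum_(i <- r) V i w).
Proof.
move=> lV; elim: r => [|i r IH].
  by under eq_fun do rewrite big_nil; exact: l2_cst.
by under eq_fun do rewrite big_cons; exact: l2D.
Qed.

Lemma int1_dot V W : l2 V -> l2 W -> int1 (fun w => dot (V w) (W w)).
Proof.
move=> [mV IV] [mW IW]; apply: int1_le (int1D _ _ IV IW).
  by apply: measurable_sum => j; apply: measurable_funM; [exact: mV|exact: mW].
by move=> w; exact: normr_dot.
Qed.

End l2.
End expectation.

(** * Smooth functions *)

Section smoothness.
Context {R : realType} {d : nat}.
Implicit Types (f : 'rV[R]_d -> R) (x y v : 'rV[R]_d).

Lemma sqn_grad_lip L f x y : 0 <= L -> smooth L f ->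
  sqn (grad f x - grad f y) <= L ^+ 2 * sqn (x - y).
Proof.
move=> L0 [_ /(_ x y)] H.
have E (v : 'rV[R]_d) : sqn v = enorm v ^+ 2 by rewrite sqr_sqrtr ?sqn_ge0.
rewrite !E -exprMn ler_sqr ?nnegrE ?mulr_ge0//; exact: sqrtr_ge0.
Qed.

Lemma diff_dot f x v : differentiable f x ->
  ('d f x : 'rV[R]_d -> R) v = dot (grad f x) v.
Proof.
move=> df; rewrite {1}(row_sum_delta v) linear_sum; apply: eq_bigr => j _ /=.
by rewrite linearZ mxE mulrC.
Qed.

(** Young's inequality with weight 1/L stands in for Cauchy-Schwarz. For [L = 0] this weight makes
    no sense, but then [w = 0]. *)
Lemma dot_le_lip (L : R) v w : 0 <= L -> sqn w <= L ^+ 2 * sqn v ->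
  dot w v <= L * sqn v.
Proof.
rewrite le_eqVlt => /predU1P[<-|L0] H.
  have Z : sqn w = 0.
    by apply/eqP; rewrite eq_le sqn_ge0 andbT (le_trans H)// expr0n/= mul0r.
  rewrite mul0r /dot big1// => j _.
  move/eqP: Z; rewrite psumr_eq0; last by move=> ? _; exact: sqr_ge0.
  move=> /allP/(_ j (mem_index_enum _)) /=; rewrite sqrf_eq0 => /eqP ->.
  by rewrite mul0r.
have := young_dot L^-1 w v; rewrite invr_gt0 invrK => /(_ L0) H2.
have H3 : L^-1 * sqn w <= L * sqn v by rewrite ler_pdivrMl// mulrA -expr2.
move: (dot w v) (L * sqn v) (L^-1 * sqn w) H2 H3 => a b c; lra.
Qed.

Lemma dot_grad_le L f x v (s : R) : 0 <= L -> smooth L f -> 0 <= s <= 1 ->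
  dot (grad f (x + s *: v)) v <= dot (grad f x) v + L * sqn v.
Proof.
move=> L0 sf /andP[s0 s1]; set z := x + s *: v.
have /dot_le_lip-/(_ L0) : sqn (grad f z - grad f x) <= L ^+ 2 * sqn v.
  apply: (le_trans (sqn_grad_lip L f z x L0 sf)).
  rewrite (_ : z - x = s *: v); last by rewrite /z [x + _]addrC addrK.
  rewrite sqnZ ler_wpM2l ?sqr_ge0// ler_piMl ?sqn_ge0//.
  by rewrite expr_le1.
by rewrite dotDl dotNl lerBlDl.
Qed.

(* Through the mean value theorem; the constant [L] instead of [L / 2] is harmless. *)
Lemma smooth_descent L f x v : 0 <= L -> smooth L f ->
  f (x + v) <= f x + dot (grad f x) v + L * sqn v.
Proof.
move=> L0 sf; have [df _] := sf.
pose phi (s : R) := f (x + s *: v).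
have dphi (s : R) : is_derive s (1 : R) phi (dot (grad f (x + s *: v)) v).
  have E : (fun h : R => h^-1 *: ((phi \o shift s) (h *: 1) - phi s))
      = (fun h : R => h^-1 *: ((f \o shift (x + s *: v)) (h *: v) - f (x + s *: v))).
    apply/funext => h /=; rewrite /phi; congr (_ *: (f _ - _)).
    by rewrite [h *: 1]mulr1 scalerDl addrCA.
  apply: DeriveDef.
    rewrite /derivable E; apply: diff_derivable; exact: df.
  by rewrite /derive E -diff_dot// -deriveE.
have cphi : {within `[0, 1], continuous phi}.
  apply: continuous_subspaceT => s; apply: differentiable_continuous.
  by apply/derivable1_diffP; have [] := dphi s.
have [s s01] := MVT ltr01 (fun s _ => dphi s) cphi.
rewrite /phi scale1r scale0r addr0 subr0 mulr1.
have /(dot_grad_le L f x v s L0 sf) : 0 <= s <= 1.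
  by move: s01; rewrite in_itv/= => /andP[/ltW -> /ltW ->].
move=> H /(canRL (subrK _)) ->; apply: (le_trans (lerD H (lexx (f x)))).
by rewrite [leLHS]addrC addrA.
Qed.

Lemma grad_favg (n : nat) (fi : 'I_n -> 'rV[R]_d -> R) x :
  (forall i, differentiable (fi i) x) ->
  grad (favg fi) x = n%:R^-1 *: \sum_(i < n) grad (fi i) x.
Proof.
move=> dfi; apply/rowP => j; rewrite mxE [RHS]mxE summxE.
have E : favg fi = n%:R^-1 \*: (\sum_(i < n) fi i).
  by apply/funext => y; rewrite /favg /= fct_sumE.
have ds : differentiable (\sum_(i < n) fi i) x by exact: differentiable_sum.
rewrite E diffZ//=; congr (_ * _).
rewrite -deriveE// derive_sum; last by move=> i; exact: diff_derivable.
by apply: eq_bigr => i _; rewrite deriveE// mxE.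
Qed.

End smoothness.

(** * Conditional moments of the oracle and of the compressor *)

Section conditioning.
Context {R : realType} {d n : nat} {dO dX dY : measure_display}
  {O : measurableType dO} (P : probability O R)
  {X : measurableType dX} (mu : probability X R)
  {Y : measurableType dY} (nu : probability Y R).

Definition indep_of {dZ} {Z : measurableType dZ} (rho : probability Z R)
    (G : set (set O)) (V : O -> Z) : Prop :=
  forall F : (g_sigma_algebraType G * Z)%type -> \bar R,
    measurable_fun setT F -> (forall p, 0 <= F p)%E ->
    (\int[P]_w F (w, V w) = \int[P]_w \int[rho]_z F (w, z))%E.

(** A bound valid for each frozen value of the other variables passes to the full expectation.
    Measurability of [F] is used over the small sigma-algebra for Tonelli, and over [O] to compare
    the integrals. *)
Lemma le_indep {dZ} {Z : measurableType dZ} (rho : probability Z R)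
    (G : set (set O)) (U : O -> Z) (F : O * Z -> R) (h : O -> R) :
  indep_of rho G U ->
  measurable_fun setT (F : (g_sigma_algebraType G * Z)%type -> R) ->
  measurable_fun setT F -> (forall p, 0 <= F p) ->
  int1 P h ->
  (forall w, \int[rho]_z (F (w, z))%:E <= (h w)%:E)%E ->
  (\int[P]_w (F (w, U w))%:E <= (Ex P h)%:E)%E.
Proof.
move=> IU mFG mF F0 Ih Fh; rewrite -(int1E _ _ Ih).
have -> := IU (fun p => (F p)%:E).
- apply: ge0_le_integral => //.
  + by move=> w _; apply: integral_ge0 => z _; rewrite lee_fin.
  + apply: (measurable_fun_fubini_tonelli_F (fun p => (F p)%:E)).
      exact/measurable_EFinP.
    by move=> p; rewrite lee_fin.
  + exact/measurable_EFinP/(int1_measurable P).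
- exact/measurable_EFinP.
- by move=> p; rewrite lee_fin.
Qed.

Section oracle.
Context (fi : 'I_n -> 'rV[R]_d -> R) (g : 'I_n -> 'rV[R]_d -> X -> 'rV[R]_d)
  (sigma : R) (Hg : stoch_oracle mu fi g sigma).
Context (G : set (set O)) (V : O -> 'rV[R]_d) (xi : O -> X) (i : 'I_n).
Hypotheses (Ixi : indep_of mu G xi) (mxi : measurable_fun setT xi)
  (mVG : mvec (V : g_sigma_algebraType G -> 'rV[R]_d)) (mV : mvec V).

Let mnoise {dT} {T : measurableType dT} (W : T -> 'rV[R]_d) : mvec W ->
  mvec (fun p : (T * X)%type => g i (W p.1) p.2 - grad (fi i) (W p.1)).
Proof.
move=> mW.
have mW1 : mvec (fun p : (T * X)%type => W p.1) by exact: (mvec_comp fst W).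
apply: mvecB; last exact: (mvec_grad mu _ fi g sigma).
by apply: mvec_jmeas => //; exact: (proj1 Hg).
Qed.

Let mnoise_xi : mvec (fun w => g i (V w) (xi w) - grad (fi i) (V w)).
Proof.
apply: mvecB; last exact: (mvec_grad mu _ fi g sigma).
by apply: mvec_jmeas => //; exact: (proj1 Hg).
Qed.

Lemma oracle_variance :
  let N := fun w => g i (V w) (xi w) - grad (fi i) (V w) in
  l2 P N /\ Ex P (fun w => sqn (N w)) <= sigma ^+ 2.
Proof.
move=> N.
suff /(int1_integral_le P _ _ (measurable_sqn N mnoise_xi)
    (fun w => sqn_ge0 (N w))) [] : (\int[P]_w (sqn (N w))%:E <= (sigma ^+ 2)%:E)%E.
  by move=> IN EN; split.
rewrite -[in leRHS](Ex_cst P (sigma ^+ 2)).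
apply: (le_indep mu G xi
  (fun p => sqn (g i (V p.1) p.2 - grad (fi i) (V p.1))) (fun=> sigma ^+ 2)) => //.
- by apply: measurable_sqn; exact: mnoise.
- by apply: measurable_sqn; exact: mnoise.
- by move=> p; exact: sqn_ge0.
- exact: int1_cst.
- by move=> w; exact: (proj2 (proj2 Hg i (V w))).
Qed.

Let noise0 x : forall j, mu.-integrable setT
    (fun z => (((g i x z - grad (fi i) x) 0 j)%:E)) /\
  (\int[mu]_z (((g i x z - grad (fi i) x) 0 j)%:E) = 0)%E.
Proof.
move=> j; have [/(_ j)[Ig Eg] _] := proj2 Hg i x.
have Ic : mu.-integrable setT (fun=> (grad (fi i) x 0 j)%:E).
  exact: finite_measure_integrable_cst.
have E : (fun z => ((g i x z - grad (fi i) x) 0 j)%:E) =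
    (fun z => (g i x z 0 j)%:E - (grad (fi i) x 0 j)%:E)%E.
  by apply/funext => z; rewrite !mxE EFinB.
rewrite E; split; first exact: integrableB.
by rewrite integralB// Eg (int1E mu _ (int1_cst mu _)) Ex_cst subee.
Qed.

(* [(Z + N)^2] and [(Z - N)^2] differ by the centred term [4 Z N], so they have the
   same conditional expectation; no signed Fubini theorem is needed. *)
Lemma oracle_centred (Z : O -> 'rV[R]_d) :
  mvec (Z : g_sigma_algebraType G -> 'rV[R]_d) -> l2 P Z ->
  Ex P (fun w => dot (Z w) (g i (V w) (xi w) - grad (fi i) (V w))) = 0.
Proof.
move=> mZG lZ.
pose N w := g i (V w) (xi w) - grad (fi i) (V w).
have lN : l2 P N by have [] := oracle_variance.
have mZ := proj1 lZ.
have mZN dT (T : measurableType dT) (W Z' : T -> 'rV[R]_d) (s : R) :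
    mvec W -> mvec Z' -> measurable_fun setT (fun p : (T * X)%type =>
      sqn (Z' p.1 + s *: (g i (W p.1) p.2 - grad (fi i) (W p.1)))).
  move=> mW mZ'; apply: measurable_sqn; apply: mvecD.
    exact: (mvec_comp fst Z').
  by apply: mvecZ; exact: mnoise.
have E (s : R) : (\int[P]_w (sqn (Z w + s *: N w))%:E
    = \int[P]_w \int[mu]_x
        (sqn (Z w + s *: (g i (V w) x - grad (fi i) (V w))))%:E)%E.
  have -> // := Ixi (fun p =>
    (sqn (Z p.1 + s *: (g i (V p.1) p.2 - grad (fi i) (V p.1))))%:E).
  - apply/measurable_EFinP; exact: (mZN _ (g_sigma_algebraType G)).
  - by move=> p; rewrite lee_fin sqn_ge0.
have H w : (\int[mu]_x (sqn (Z w + 1 *: (g i (V w) x - grad (fi i) (V w))))%:E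
    = \int[mu]_x (sqn (Z w + (-1) *: (g i (V w) x - grad (fi i) (V w))))%:E)%E.
  set M := fun x => g i (V w) x - grad (fi i) (V w).
  have lM : l2 mu M.
    have mM : mvec M.
      apply: mvecB; last exact: mvec_cst.
      by apply: (mvec_jmeas (g i) (fun=> V w) id) => //; exact: (proj1 Hg).
    split=> //; apply: int1_ge0P; first exact: measurable_sqn.
      by move=> x; exact: sqn_ge0.
    apply: (le_lt_trans (proj2 (proj2 Hg i (V w)))); exact: ltry.
  have lZM (s : R) : int1 mu (fun x => sqn (Z w + s *: M x)).
    by apply: (proj2 (l2D _ _ _ (l2_cst mu (Z w)) (l2Z _ s _ lM))).
  rewrite (int1E _ _ (lZM 1)) (int1E _ _ (lZM (-1))); congr EFin.
  have IM j : int1 mu (fun x => M x 0 j) by exact: (proj1 (noise0 (V w) j)).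
  have D0 : Ex mu (fun x => dot (Z w) (M x)) = 0.
    rewrite Ex_sum; last by move=> j; exact: int1Z.
    rewrite big1// => j _; rewrite ExZ// /Ex /Rintegral.
    by rewrite (proj2 (noise0 (V w) j)) /= mulr0.
  have Idot : int1 mu (fun x => dot (Z w) (M x)).
    exact: (int1_dot _ _ _ (l2_cst mu (Z w)) lM).
  have [_ IMM] := lM.
  have F (s : R) : s ^+ 2 = 1 -> Ex mu (fun x => sqn (Z w + s *: M x))
      = sqn (Z w) + Ex mu (fun x => sqn (M x)).
    move=> s2; under [X in Ex _ X]eq_fun do rewrite sqnD dotZr sqnZ s2 mul1r mulrA.
    rewrite ExD//; last by apply: int1D; [exact: int1_cst|exact: int1Z].
    rewrite ExD//; [|exact: int1_cst|exact: int1Z].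
    by rewrite ExZ// D0 mulr0 addr0 Ex_cst.
  by rewrite !F ?sqrrN ?expr1n.
have lZN (s : R) : int1 P (fun w => sqn (Z w + s *: N w)).
  exact: (proj2 (l2D _ _ _ lZ (l2Z _ s _ lN))).
have EE : (\int[P]_w (sqn (Z w + 1 *: N w))%:E
    = \int[P]_w (sqn (Z w + (-1) *: N w))%:E)%E.
  by rewrite (E 1) (E (-1)); apply: eq_integral => w _; rewrite H.
have {}EE : Ex P (fun w => sqn (Z w + 1 *: N w)) = Ex P (fun w => sqn (Z w + (-1) *: N w)).
  exact: (congr1 fine EE).
have -> : (fun w => dot (Z w) (N w)) =
    (fun w => 4^-1 * (sqn (Z w + 1 *: N w) - sqn (Z w + (-1) *: N w))).
  apply/funext => w; rewrite !sqnD !dotZr !sqnZ.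
  by move: (sqn (Z w)) (dot (Z w) (N w)) (sqn (N w)) => a b c; field.
by rewrite ExZ ?ExB// ?EE ?subrr ?mulr0//; exact: int1B.
Qed.

End oracle.

Lemma compressor_contract (delta : R) (C : 'rV[R]_d -> Y -> 'rV[R]_d)
    (G : set (set O)) (V : O -> 'rV[R]_d) (zeta : O -> Y) :
  compressor nu delta C -> indep_of nu G zeta -> measurable_fun setT zeta ->
  mvec (V : g_sigma_algebraType G -> 'rV[R]_d) -> l2 P V ->
  let N := fun w => V w - C (V w) (zeta w) in
  l2 P N /\ Ex P (fun w => sqn (N w)) <= (1 - delta) * Ex P (fun w => sqn (V w)).
Proof.
move=> [mC HC] Iz mz mVG [mV IV] N.
have mN dT (T : measurableType dT) (W : T -> 'rV[R]_d) : mvec W ->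
    measurable_fun setT (fun p : (T * Y)%type => sqn (C (W p.1) p.2 - W p.1)).
  move=> mW; have mW1 : mvec (fun p : (T * Y)%type => W p.1).
    exact: (mvec_comp fst W).
  by apply: measurable_sqn; apply: mvecB => //; exact: mvec_jmeas.
have mNw : mvec N by apply: mvecB => //; exact: mvec_jmeas.
suff /(int1_integral_le P _ _ (measurable_sqn N mNw)
    (fun w => sqn_ge0 (N w))) [] : (\int[P]_w (sqn (N w))%:E
      <= ((1 - delta) * Ex P (fun w => sqn (V w)))%:E)%E.
  by move=> IN EN; split.
rewrite -ExZ//.
under eq_integral do rewrite -sqnN opprB.
apply: (le_indep nu G zeta (fun p => sqn (C (V p.1) p.2 - V p.1))
  (fun w => (1 - delta) * sqn (V w))) => //.
- exact: mN.
- exact: mN.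
- by move=> p; exact: sqn_ge0.
- exact: int1Z.
- by move=> w; exact: (HC (V w)).
Qed.

End conditioning.

(** * Real recursions *)

Section lyapunov.
Context {R : realType}.

(* With [X] = gamma^3 L^2 / delta^4, the Lyapunov weights are 16 X delta^3 for the errors
   [E] and 1024 X delta for the compressed vectors [U]; the coefficients of [E] and [U]
   then cancel exactly. *)
Lemma lyapunov_step (X delta gamma s2 E U N E' U' k2 : R) :
  0 < delta -> delta <= 1 -> 0 < gamma -> 0 <= X -> 0 <= E -> 0 <= U -> 0 <= N ->
  0 <= s2 -> 0 <= k2 -> k2 <= (delta / 100) ^+ 2 -> 100 * (X * delta ^+ 2) <= gamma ->
  E' <= (1 - delta / 16) * E + 16 / delta * U ->
  U' <= (1 - delta / 2) * U + 9 / delta * (2 * (delta / 16) ^+ 4 * E + 16 * s2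
    + 4 * k2 * (2 * N + 4 * (delta / 16) ^+ 2 * E + 8 * s2 + 8 * U)) ->
  16 * X * delta ^+ 3 * E' + 32 ^+ 2 * X * delta * U' + 2^-1 * (X * delta ^+ 4) * E
  <= 16 * X * delta ^+ 3 * E + 32 ^+ 2 * X * delta * U + gamma / 8 * N
     + 390 ^+ 2 * X * s2.
Proof.
move=> d0 d1 g0 X0 E0 U0 N0 s0 k0 kd Xg HE HU.
have HE' : delta * E' <= (delta - delta ^+ 2 / 16) * E + 16 * U.
  rewrite -ler_pdivlMl//; apply: (le_trans HE); rewrite le_eqVlt; apply/orP; left.
  by apply/eqP; field; rewrite gt_eqF.
set S := 2 * N + 4 * (delta / 16) ^+ 2 * E + 8 * s2 + 8 * U in HU.
have S0 : 0 <= S.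
  have : 0 <= (delta / 16) ^+ 2 * E by rewrite mulr_ge0 ?sqr_ge0.
  by rewrite /S; lra.
have HS : k2 * S <= (delta / 100) ^+ 2 * S by rewrite ler_wpM2r.
(* The rate delta/2 drops to delta/4 to absorb the [U] part of [S]. After weighting by 32^2 X, the
   remaining decay of [U] offsets the 256 X delta^2 U produced by [XE], and the [E] term costs half
   of the decay X delta^4 E. *)
have HU' : delta * U' <= (delta - delta ^+ 2 / 4) * U + delta ^+ 4 / (2 * 32 ^+ 2) * E
    + 145 * s2 + delta ^+ 2 / 100 * N.
  have H1 : delta * U' <= (delta - delta ^+ 2 / 2) * U + 9 * (2 * (delta / 16) ^+ 4 * E
      + 16 * s2 + 4 * k2 * S).
    rewrite -ler_pdivlMl//; apply: (le_trans HU); rewrite le_eqVlt; apply/orP; left.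
    by apply/eqP; field; rewrite gt_eqF.
  have e1 : (delta / 100) ^+ 2 * S = delta ^+ 2 * N / (50 * 100)
      + delta ^+ 4 * E / 800 ^+ 2 + delta ^+ 2 * s2 / (25 * 50) + delta ^+ 2 * U / (25 * 50).
    by rewrite /S; field.
  have e2 : (delta / 16) ^+ 4 * E = delta ^+ 4 * E / 16 ^+ 4 by field.
  have d2 : delta ^+ 2 <= 1 by rewrite expr_le1// ltW.
  have h1 : delta ^+ 2 * s2 <= s2 by rewrite ler_piMl.
  have h2 : 0 <= delta ^+ 2 * N by rewrite mulr_ge0 ?sqr_ge0.
  have h3 : 0 <= delta ^+ 2 * U by rewrite mulr_ge0 ?sqr_ge0.
  have h4 : 0 <= delta ^+ 4 * E by rewrite mulr_ge0 ?exprn_ge0 ?(ltW d0).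
  rewrite e1 in HS.
  have H2 : delta * U' <= (delta - delta ^+ 2 / 2) * U + 9 * (2 * (delta ^+ 4 * E / 16 ^+ 4)
      + 16 * s2 + 4 * (k2 * S)) by rewrite -e2 !mulrA; rewrite !mulrA in H1.
  by lra.
(* The weight 32^2 / 100 of [N] is below 11, and 11/100 is below 1/8. *)
have HN : 11 * (X * delta ^+ 2) * N <= gamma / 8 * N by rewrite ler_wpM2r//; lra.
have XE : 16 * X * delta ^+ 2 * (delta * E')
    <= 16 * X * delta ^+ 2 * ((delta - delta ^+ 2 / 16) * E + 16 * U).
  by rewrite ler_wpM2l// mulr_ge0 ?sqr_ge0// mulr_ge0.
have XU : 32 ^+ 2 * X * (delta * U') <= 32 ^+ 2 * X * ((delta - delta ^+ 2 / 4) * U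
    + delta ^+ 4 / (2 * 32 ^+ 2) * E + 145 * s2 + delta ^+ 2 / 100 * N).
  by rewrite ler_wpM2l// mulr_ge0 ?sqr_ge0.
have Xs : 0 <= X * s2 by rewrite mulr_ge0.
have XN : 0 <= X * delta ^+ 2 * N by rewrite mulr_ge0// mulr_ge0 ?sqr_ge0.
by lra.
Qed.

(** Since X delta^4 = gamma (gamma L)^2, the error term of the descent inequality is exactly the one
    that the Lyapunov sum controls, at the price of gamma/8 times the sum of [N]. With the gamma/100
    lost to L gamma^2, more than gamma/8 of the initial gamma/2 survives. *)
Lemma lyapunov_sum (delta gamma L Lt s2 v F0 : R) (E U N : nat -> R) :
  0 < delta -> delta <= 1 -> 0 < gamma -> 0 <= L -> L <= Lt ->
  gamma * Lt <= delta / 100 -> 0 <= s2 -> 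
  (forall t, 0 <= E t) -> (forall t, 0 <= U t) -> (forall t, 0 <= N t) ->
  E 0 = 0 -> U 0 <= 4 * s2 ->
  (forall t, E t.+1 <= (1 - delta / 16) * E t + 16 / delta * U t) ->
  (forall t, U t.+1 <= (1 - delta / 2) * U t + 9 / delta * (2 * (delta / 16) ^+ 4 * E t
    + 16 * s2 + 4 * (gamma * Lt) ^+ 2
        * (2 * N t + 4 * (delta / 16) ^+ 2 * E t + 8 * s2 + 8 * U t))) ->
  (forall T, 0 <= F0 + \sum_(t < T) (gamma * (2^-1 * (gamma * L) ^+ 2 * E t - 2^-1 * N t)
     + L * gamma ^+ 2 * (N t + v))) ->
  forall T, gamma / 8 * \sum_(t < T.+1) N t
    <= F0 + T.+1%:R * (L * gamma ^+ 2 * v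
         + 400 ^+ 2 * (gamma * (gamma * L / delta ^+ 2) ^+ 2) * s2).
Proof.
move=> d0 d1 g0 L0 LLt glt s0 E0 U0 N0 E00 U00 HE HU HF T.
pose X := gamma * (gamma * L / delta ^+ 2) ^+ 2.
have X0 : 0 <= X by rewrite mulr_ge0 ?sqr_ge0 ?ltW.
have XE : X * delta ^+ 4 = gamma * (gamma * L) ^+ 2.
  by rewrite /X; field; rewrite gt_eqF.
have gL0 : 0 <= gamma * L by rewrite mulr_ge0// ltW.
have gLt : gamma * L <= gamma * Lt by rewrite ler_wpM2l// ltW.
have gLd : gamma * L <= delta / 100 by exact: le_trans glt.
have gLd2 : (gamma * L) ^+ 2 <= (delta / 100) ^+ 2.
  by rewrite ler_sqr// nnegrE// divr_ge0// ltW.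
have Xg : 100 * (X * delta ^+ 2) <= gamma.
  have -> : X * delta ^+ 2 = gamma * ((gamma * L) ^+ 2 / delta ^+ 2).
    by rewrite /X; field; rewrite gt_eqF.
  have h : (gamma * L) ^+ 2 / delta ^+ 2 <= (100 ^+ 2)^-1.
    rewrite ler_pdivrMr ?exprn_gt0// (le_trans gLd2)// le_eqVlt; apply/orP; left.
    by apply/eqP; field.
  have : gamma * ((gamma * L) ^+ 2 / delta ^+ 2) <= gamma * (100 ^+ 2)^-1.
    by rewrite ler_wpM2l// ltW.
  by lra.
have k0 : 0 <= (gamma * Lt) ^+ 2 by exact: sqr_ge0.
have kd : (gamma * Lt) ^+ 2 <= (delta / 100) ^+ 2.
  by rewrite ler_sqr// nnegrE ?(le_trans gL0)// divr_ge0// ltW.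
have step t := lyapunov_step X delta gamma s2 _ _ _ _ _ _ d0 d1 g0 X0 (E0 t) (U0 t)
  (N0 t) s0 k0 kd Xg (HE t) (HU t).
(* The constant 64^2 is the initial Lyapunov value: weight 32^2 times the bound 4 s2 on [U 0], while
   [E 0] vanishes. *)
have tele M : 16 * X * delta ^+ 3 * E M + 32 ^+ 2 * X * delta * U M
    + \sum_(t < M) 2^-1 * (X * delta ^+ 4) * E t
    <= 64 ^+ 2 * X * s2 + \sum_(t < M) (gamma / 8 * N t + 390 ^+ 2 * X * s2).
  elim: M => [|M IH].
    rewrite !big_ord0 E00 mulr0 add0r !addr0.
    have h1 : 32 ^+ 2 * X * delta * U 0 <= 32 ^+ 2 * X * delta * (4 * s2).
      by rewrite ler_wpM2l// mulr_ge0 ?(ltW d0)// mulr_ge0 ?sqr_ge0.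
    have h2 : X * s2 * delta <= X * s2 by rewrite ler_piMr// mulr_ge0.
    by lra.
  by rewrite !big_ord_recr/=; have := step M; lra.
have FT := HF T.+1; have TT := tele T.+1.
have P1 : 0 <= 16 * X * delta ^+ 3 * E T.+1.
  by rewrite mulr_ge0// mulr_ge0 ?exprn_ge0 ?(ltW d0)// mulr_ge0.
have P2 : 0 <= 32 ^+ 2 * X * delta * U T.+1.
  by rewrite mulr_ge0// mulr_ge0 ?(ltW d0)// mulr_ge0 ?sqr_ge0.
set SN := \sum_(t < T.+1) N t.
pose SE := \sum_(t < T.+1) E t.
have TT' : 2^-1 * (X * delta ^+ 4) * SE <= 64 ^+ 2 * X * s2 + (gamma / 8 * SN
    + T.+1%:R * (390 ^+ 2 * X * s2)).
  move: TT; rewrite -mulr_sumr big_split/= -mulr_sumr sumr_const card_ord.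
  rewrite -/SE -/SN -[in X in _ <= X]mulr_natl; lra.
have FT' : 0 <= F0 + (gamma * (2^-1 * (gamma * L) ^+ 2) * SE - gamma * 2^-1 * SN
    + L * gamma ^+ 2 * (SN + T.+1%:R * v)).
  move: FT; rewrite big_split/= -!mulr_sumr sumrB -!mulr_sumr big_split/=.
  rewrite sumr_const card_ord -/SE -/SN -[v *+ _]mulr_natl; lra.
have SN0 : 0 <= SN by apply: sumr_ge0 => i _; exact: N0.
have h3 : L * gamma ^+ 2 * SN <= gamma / 100 * SN.
  rewrite ler_wpM2r// (_ : L * gamma ^+ 2 = gamma * (gamma * L)); last by ring.
  by rewrite ler_wpM2l ?(ltW g0)// (le_trans gLd)//; lra.
(* The initial value is paid only once and fits into the noise terms: 64^2 + 390^2 <= 400^2. *)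
have h4 : X * s2 <= T.+1%:R * (X * s2).
  by rewrite ler_peMl ?ler1n// mulr_ge0.
have h6 : 0 <= X * s2 by rewrite mulr_ge0.
have h5 : 0 <= gamma * SN by rewrite mulr_ge0// ltW.
rewrite -/X; rewrite XE in TT'.
by lra.
Qed.

(** The initial gap, the averaged noise and the compression noise each cost at most gamma eps / 32
    per iteration, together less than the allowance gamma eps / 8. *)
Lemma stepsize_bound (delta gamma L s2 eps nn F0 S : R) (T : nat) (sigma : R) :
  0 < delta -> 0 < gamma -> 0 <= L -> 0 < eps -> 0 < nn -> 0 <= sigma -> 0 <= F0 ->
  s2 = sigma ^+ 2 ->
  gamma * (32 * (L * s2 / (nn * eps))) <= 1 ->
  gamma * (23 * 100 * (L * sigma / (delta ^+ 2 * Num.sqrt eps))) <= 1 ->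
  32 * F0 / (gamma * eps) <= T.+1%:R ->
  gamma / 8 * S <= F0 + T.+1%:R * (L * gamma ^+ 2 * (s2 / nn)
         + 400 ^+ 2 * (gamma * (gamma * L / delta ^+ 2) ^+ 2) * s2) ->
  T.+1%:R^-1 * S <= eps.
Proof.
move=> d0 g0 L0 e0 n0 sg0 F00 -> H1 H2 HT HS.
have T0 : 0 < (T.+1%:R : R) by rewrite ltr0n.
rewrite ler_pdivrMl//.
set t := (T.+1%:R : R) in T0 HT HS *.
have HF : F0 <= gamma * eps * t / 32.
  by move: HT; rewrite ler_pdivrMr ?mulr_gt0//; lra.
have Hv : L * gamma ^+ 2 * (sigma ^+ 2 / nn) <= gamma * eps / 32.
  have -> : L * gamma ^+ 2 * (sigma ^+ 2 / nn)
      = gamma * eps / 32 * (gamma * (32 * (L * sigma ^+ 2 / (nn * eps)))).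
    by field; rewrite !gt_eqF.
  by rewrite ler_piMr// ltW// divr_gt0// mulr_gt0.
(* This term is quadratic in the quantity bounded by [H2], which is where the square root of eps
   comes from; 2300 is chosen so that (400 / 2300)^2 < 1/32. *)
have Hs : 400 ^+ 2 * (gamma * (gamma * L / delta ^+ 2) ^+ 2) * sigma ^+ 2
    <= gamma * eps / 32.
  set q := gamma * (23 * 100 * _) in H2.
  have q0 : 0 <= q.
    rewrite /q; apply: mulr_ge0; first exact: ltW.
    apply: mulr_ge0; first by rewrite mulr_ge0.
    by rewrite divr_ge0 ?mulr_ge0 ?exprn_ge0 ?sqrtr_ge0 ?(ltW d0).
  have q1 : q ^+ 2 <= 1 by rewrite expr_le1.
  have se : Num.sqrt eps ^+ 2 = eps by rewrite sqr_sqrtr// ltW.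
  have -> : 400 ^+ 2 * (gamma * (gamma * L / delta ^+ 2) ^+ 2) * sigma ^+ 2
      = gamma * Num.sqrt eps ^+ 2 * (400 ^+ 2 / (23 * 100) ^+ 2) * q ^+ 2.
    by rewrite /q; field; rewrite !gt_eqF ?sqrtr_gt0.
  rewrite se.
  have : gamma * eps * (400 ^+ 2 / (23 * 100) ^+ 2) * q ^+ 2
      <= gamma * eps * (400 ^+ 2 / (23 * 100) ^+ 2).
    by rewrite ler_piMr// mulr_ge0 ?divr_ge0 ?sqr_ge0// mulr_ge0// ltW.
  by have := mulr_gt0 g0 e0; lra.
have : t * (L * gamma ^+ 2 * (sigma ^+ 2 / nn)
    + 400 ^+ 2 * (gamma * (gamma * L / delta ^+ 2) ^+ 2) * sigma ^+ 2)
    <= t * (gamma * eps / 16) by rewrite ler_wpM2l ?(ltW T0)//; lra.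
move=> Ht; have : gamma * S <= gamma * (t * eps) by lra.
by rewrite ler_pM2l.
Qed.

End lyapunov.

(** * Vector and scalar inequalities behind the recursions *)

Lemma sqn_sum {R : realType} {d n : nat} (v : 'I_n -> 'rV[R]_d) :
  sqn (\sum_(i < n) v i) = \sum_(j < n) \sum_(i < n) dot (v i) (v j).
Proof.
rewrite -dotvv dot_sumr; apply: eq_bigr => j _.
by rewrite dotC dot_sumr; apply: eq_bigr => i _; rewrite dotC.
Qed.

Lemma sqnB2_double {R : realType} {d : nat} (u v : 'rV[R]_d) :
  2 * sqn (u - v) <= 4 * sqn u + 4 * sqn v.
Proof. by have := sqnB2 u v; lra. Qed.

Lemma sqn_scale_sub {R : realType} {d : nat} (a : R) (u v w : 'rV[R]_d) :
  sqn (a *: u + (v - w)) <= 2 * a ^+ 2 * sqn u + (4 * sqn v + 4 * sqn w).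
Proof.
apply: (le_trans (sqnD2 _ _)); rewrite sqnZ mulrA lerD2l.
exact: sqnB2_double.
Qed.

(** Young's inequality with parameter a / (1 - a), tuned so that the square of [u] keeps the exact
    factor 1 - a. *)
Lemma sqn_convex {R : realType} {d : nat} (a : R) (u v : 'rV[R]_d) : 0 < a -> a < 1 ->
  sqn ((1 - a) *: u + v) <= (1 - a) * sqn u + a^-1 * sqn v.
Proof.
move=> a0 a1.
have b0 : 0 < 1 - a by rewrite subr_gt0.
have := young_sqn (a / (1 - a)) ((1 - a) *: u) v (divr_gt0 a0 b0).
rewrite sqnZ mulrA.
have -> : (1 + a / (1 - a)) * (1 - a) ^+ 2 = 1 - a by field; rewrite gt_eqF.
by have -> // : 1 + (a / (1 - a))^-1 = a^-1 by field; rewrite !gt_eqF.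
Qed.

(** The growth factors multiply to at most 1 + delta/2, which leaves half of the contraction; eta
    has to be a small multiple of delta for this. *)
Lemma contraction_factor {R : realType} (delta eta : R) : 0 < delta -> delta <= 1 ->
  eta = 16^-1 * delta ->
  (1 + delta / 8) * (1 + eta) ^+ 2 * (1 - delta) <= 1 - delta / 2.
Proof.
move=> d0 d1 ->.
have d2 : 0 <= delta ^+ 2 by exact: sqr_ge0.
have d3 : delta ^+ 2 <= delta by rewrite expr2 ler_piMl// ltW.
have d4 : delta ^+ 3 <= delta ^+ 2 by rewrite exprS ler_piMl.
apply: (@le_trans _ _ ((1 + delta / 2) * (1 - delta))); last by lra.
by rewrite ler_wpM2r ?subr_ge0//; lra.
Qed.

(** Scalar form of the step on u. The Young parameter delta/8 preserves the contraction, and 1 +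
    8/delta <= 9/delta is the price put on every perturbation. *)
Lemma residual_step_scalar {R : realType} (delta eta r2 u2 e2 w2 w2' D l s2 : R) :
  0 < delta -> delta <= 1 -> eta = 16^-1 * delta ->
  0 <= e2 -> 0 <= D -> 0 <= l -> 0 <= s2 -> 0 <= u2 ->
  r2 <= (1 - delta) * u2 -> w2 <= s2 -> w2' <= s2 ->
  (1 + delta / 8) * ((1 + eta) ^+ 2 * r2) + (1 + (delta / 8)^-1)
    * (2 * (eta ^+ 4 * e2) + 2 * (4 * w2' + 4 * w2 + 2 * (l ^+ 2 * D)))
  <= (1 - delta / 2) * u2
     + 9 / delta * (2 * (delta / 16) ^+ 4 * e2 + 16 * s2 + 4 * (l ^+ 2 * D)).
Proof.
move=> d0 d1 He e0 D0 l0 s0 u0 Hr Hw Hw'.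
have H1 : (1 + delta / 8) * ((1 + eta) ^+ 2 * r2) <= (1 - delta / 2) * u2.
  apply: (@le_trans _ _ ((1 + delta / 8) * (1 + eta) ^+ 2 * ((1 - delta) * u2))).
    rewrite [leLHS]mulrA; apply: ler_wpM2l => //.
    by rewrite mulr_ge0 ?sqr_ge0// addr_ge0// divr_ge0// ltW.
  by rewrite [leLHS]mulrA ler_wpM2r// contraction_factor.
have lD : 0 <= l ^+ 2 * D by rewrite mulr_ge0 ?sqr_ge0.
have E0 : 0 <= eta ^+ 4 * e2.
  by rewrite He mulr_ge0 ?exprn_ge0 ?mulr_ge0 ?(ltW d0).
have -> : (delta / 16) ^+ 4 = eta ^+ 4 by rewrite He mulrC.
have H2 : 1 + (delta / 8)^-1 <= 9 / delta.
  have -> : 1 + (delta / 8)^-1 = (delta + 8) / delta by field; rewrite gt_eqF.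
  by rewrite ler_wpM2r ?invr_ge0 ?(ltW d0)//; lra.
apply: lerD => //.
set A := 2 * (eta ^+ 4 * e2) + _; set B := 2 * eta ^+ 4 * e2 + _ + _.
have B0 : 0 <= B by rewrite /B; lra.
have AB : A <= B by rewrite /A /B; lra.
apply: (@le_trans _ _ ((1 + (delta / 8)^-1) * B)); last by rewrite ler_wpM2r.
by rewrite ler_wpM2l// addr_ge0// invr_ge0 divr_ge0// ltW.
Qed.

Section combination.
Context {R : realType} {dO : measure_display} {O : measurableType dO}
  (P : probability O R) (f1 f2 f3 f4 f5 : O -> R) (a b p q l : R).
Hypotheses (i1 : int1 P f1) (i2 : int1 P f2) (i3 : int1 P f3) (i4 : int1 P f4)
  (i5 : int1 P f5).

Let j34 : int1 P (fun w => 4 * f3 w + 4 * f4 w).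
Proof. exact: int1D (int1Z P 4 _ i3) (int1Z P 4 _ i4). Qed.

Let j5 : int1 P (fun w => 2 * (l * f5 w)).
Proof. exact: (int1Z P 2 _ (int1Z P l _ i5)). Qed.

Let j2 : int1 P (fun w => 2 * (q * f2 w)).
Proof. exact: (int1Z P 2 _ (int1Z P q _ i2)). Qed.

Let j345 : int1 P (fun w => 4 * f3 w + 4 * f4 w + 2 * (l * f5 w)).
Proof. exact: (int1D P _ _ j34 j5). Qed.

Let j2345 : int1 P (fun w => 2 * (q * f2 w)
  + 2 * (4 * f3 w + 4 * f4 w + 2 * (l * f5 w))).
Proof. exact: (int1D P _ _ j2 (int1Z P 2 _ j345)). Qed.

(** The integrand has the shape of the pointwise bound on the square of [uu t.+1 i]: compression
    error, error, two noises and displacement. *)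
Lemma int1_combination : int1 P (fun w => a * (p * f1 w) + b * (2 * (q * f2 w)
  + 2 * (4 * f3 w + 4 * f4 w + 2 * (l * f5 w)))).
Proof.
exact: (int1D P _ _ (int1Z P a _ (int1Z P p _ i1)) (int1Z P b _ j2345)).
Qed.

Lemma Ex_combination : Ex P (fun w => a * (p * f1 w) + b * (2 * (q * f2 w)
    + 2 * (4 * f3 w + 4 * f4 w + 2 * (l * f5 w))))
  = a * (p * Ex P f1) + b * (2 * (q * Ex P f2)
    + 2 * (4 * Ex P f3 + 4 * Ex P f4 + 2 * (l * Ex P f5))).
Proof.
rewrite (ExD P _ _ (int1Z P a _ (int1Z P p _ i1)) (int1Z P b _ j2345)).
rewrite (ExZ P a _ (int1Z P p _ i1)) (ExZ P p _ i1) (ExZ P b _ j2345).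
rewrite (ExD P _ _ j2 (int1Z P 2 _ j345)) (ExZ P 2 _ (int1Z P q _ i2)) (ExZ P q _ i2).
rewrite (ExZ P 2 _ j345) (ExD P _ _ j34 j5) (ExD P _ _ (int1Z P 4 _ i3) (int1Z P 4 _ i4)).
by rewrite (ExZ P 4 _ i3) (ExZ P 4 _ i4) (ExZ P 2 _ (int1Z P l _ i5)) (ExZ P l _ i5).
Qed.

(** Tailored to [bound], the right-hand side of the descent inequality. *)
Lemma int1_linear5 : int1 P (fun w =>
  a * f1 w + (b * f2 w + (p * f3 w + (q * f4 w + l * f5 w)))).
Proof.
exact: (int1D P _ _ (int1Z P a _ i1) (int1D P _ _ (int1Z P b _ i2)
  (int1D P _ _ (int1Z P p _ i3) (int1D P _ _ (int1Z P q _ i4) (int1Z P l _ i5))))).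
Qed.

Lemma Ex_linear5 (v1 v2 v3 v4 v5 : R) : Ex P f1 = v1 -> Ex P f2 = v2 ->
  Ex P f3 = v3 -> Ex P f4 = v4 -> Ex P f5 = v5 ->
  Ex P (fun w => a * f1 w + (b * f2 w + (p * f3 w + (q * f4 w + l * f5 w))))
  = a * v1 + (b * v2 + (p * v3 + (q * v4 + l * v5))).
Proof.
move=> <- <- <- <- <-.
have k1 := int1Z P a _ i1; have k2 := int1Z P b _ i2; have k3 := int1Z P p _ i3.
have k4 := int1Z P q _ i4; have k5 := int1Z P l _ i5.
have k45 := int1D P _ _ k4 k5; have k345 := int1D P _ _ k3 k45.
rewrite (ExD P _ _ k1 (int1D P _ _ k2 k345)) (ExD P _ _ k2 k345).
rewrite (ExD P _ _ k3 k45) (ExD P _ _ k4 k5).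
by rewrite (ExZ P a _ i1) (ExZ P b _ i2) (ExZ P p _ i3) (ExZ P q _ i4) (ExZ P l _ i5).
Qed.
End combination.

(* [x] and [v] are the gradients at the actual and at the virtual iterate, [m] the
   averaged noise; polarization turns [- dot v x] into [sqn (v - x)] minus squares. *)
Lemma descent_term {R : realType} {d : nat} (gamma L c : R) (v x m : 'rV[R]_d) :
  0 <= gamma -> sqn (v - x) <= c ->
  dot v (- (gamma *: (x + m))) + L * sqn (- (gamma *: (x + m)))
  <= gamma * 2^-1 * c + ((- gamma / 2 + L * gamma ^+ 2) * sqn x
     + (- gamma * dot v m + (2 * L * gamma ^+ 2 * dot x m + L * gamma ^+ 2 * sqn m))).
Proof.
move=> g0 H; rewrite sqnN sqnZ dotNr dotZr dotDr sqnD.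
move: H; rewrite sqnD sqnN dotNr; have := sqn_ge0 v.
move: (sqn v) (sqn x) (sqn m) (dot v x) (dot v m) (dot x m) => a b e f h k a0 H.
have Hg : gamma * (a + 2 * - f + b) <= gamma * c by rewrite ler_wpM2l.
have Ha : 0 <= gamma * a by rewrite mulr_ge0.
by lra.
Qed.

(** The explicit zeros are the expectations of the two noise cross terms, left in place to match
    [Ex_linear5]. *)
Lemma descent_value {R : realType} (gamma L k a b e f : R) :
  L * gamma ^+ 2 * e <= L * gamma ^+ 2 * f ->
  gamma * 2^-1 * (k * a) + ((- gamma / 2 + L * gamma ^+ 2) * b
    + (- gamma * 0 + (2 * L * gamma ^+ 2 * 0 + L * gamma ^+ 2 * e)))
  <= gamma * (2^-1 * k * a - 2^-1 * b) + L * gamma ^+ 2 * (b + f).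
Proof. by lra. Qed.

(** * Analysis of EControl *)

Section econtrol.
Context {R : realType} {d n : nat} {dO dX dY : measure_display}
  {O : measurableType dO} (P : probability O R)
  {X : measurableType dX} (mu : probability X R)
  {Y : measurableType dY} (nu : probability Y R)
  (fi : 'I_n -> 'rV[R]_d -> R) (L : R) (Li : 'I_n -> R) (sigma delta gamma : R)
  (x0 : 'rV[R]_d) (g : 'I_n -> 'rV[R]_d -> X -> 'rV[R]_d)
  (C : 'rV[R]_d -> Y -> 'rV[R]_d)
  (xi : nat -> 'I_n -> O -> X) (zeta : nat -> 'I_n -> O -> Y).
Hypotheses (n0 : (0 < n)%N) (delta0 : 0 < delta) (delta1 : delta <= 1)
  (gamma0 : 0 < gamma) (L0 : 0 <= L) (Li0 : forall i, 0 <= Li i)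
  (sf : smooth L (favg fi)) (sfi : forall i, smooth (Li i) (fi i))
  (Hg : stoch_oracle mu fi g sigma) (HC : compressor nu delta C)
  (Hiid : iid_noise P mu nu xi zeta).

(* [xx], [ee], [hh], [hb], [gg] are the paper's x_t, e_t^i, h_t^i, h_t, g_t^i; [nz] is the
   oracle noise, [uu] the compressed vector, [rr] its compression error and [vv] the
   virtual iterate. *)
Let eta : R := 16^-1 * delta.
Let avg (v : 'I_n -> 'rV[R]_d) : 'rV[R]_d := n%:R^-1 *: \sum_(i < n) v i.
Let xx t w := sx (run_at g C x0 gamma eta xi zeta t w).
Let ee t i w := se (run_at g C x0 gamma eta xi zeta t w) i.
Let hh t i w := sh (run_at g C x0 gamma eta xi zeta t w) i.
Let hb t w := shb (run_at g C x0 gamma eta xi zeta t w).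
Let gg t i w := g i (xx t w) (xi t.+1 i w).
Let nz t i w := gg t i w - grad (fi i) (xx t w).
Let uu t i w := eta *: ee t i w + gg t i w - hh t i w.
Let rr t i w := uu t i w - C (uu t i w) (zeta t i w).
Let vv t w := xx t w - gamma *: avg (fun i => ee t i w).

(** * Algebra of one iteration *)

Let eta0 : 0 < eta. Proof. by rewrite mulr_gt0. Qed.
Let eta1 : eta < 1. Proof. by rewrite /eta; move: delta1; lra. Qed.

Let eeS t i w : ee t.+1 i w = (1 - eta) *: ee t i w + rr t i w.
Proof.
rewrite /rr; set D := C _ _.
have -> : ee t.+1 i w = ee t i w + gg t i w - hh t i w - D by [].
rewrite scalerBl scale1r /uu.
by rewrite -!addrA; congr (_ + _); rewrite !addrA addNr add0r.
Qed.

Let hhS t i w : hh t.+1 i w = eta *: ee t i w + gg t i w - rr t i w.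
Proof.
rewrite /rr; set D := C _ _.
have -> : hh t.+1 i w = hh t i w + D by [].
by rewrite /uu -[X in _ = _ - X]addrA -opprD opprB addrCA subrr addr0.
Qed.

Let avgD u v : avg (fun i => u i + v i) = avg u + avg v.
Proof. by rewrite /avg big_split scalerDr. Qed.

Let avgB u v : avg (fun i => u i - v i) = avg u - avg v.
Proof. by rewrite /avg sumrB scalerBr. Qed.

Let hbE t w : hb t w = avg (fun i => hh t i w).
Proof.
elim: t => [//|t IH].
have -> : hb t.+1 w = hb t w + avg (fun i => C (uu t i w) (zeta t i w)) by [].
by rewrite IH -avgD.
Qed.

Let xxS t w : xx t.+1 w = xx t w - gamma *: avg (fun i => hh t.+1 i w).
Proof.
have -> : xx t.+1 w = xx t w - gamma *: hb t w
  - (gamma / n%:R) *: \sum_(i < n) C (uu t i w) (zeta t i w) by [].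
rewrite hbE -scalerA -addrA -opprD -scalerDr -/(avg _) -avgD.
by [].
Qed.

(** Client by client, e + g = e^+ + h^+: what is not transmitted stays in e. The compressed messages
    therefore cancel from the virtual iterate. *)
Let vvS t w : vv t.+1 w = vv t w - gamma *: avg (fun i => gg t i w).
Proof.
rewrite /vv xxS.
have -> : avg (fun i => ee t.+1 i w) = avg (fun i => ee t i w)
    + avg (fun i => gg t i w) - avg (fun i => hh t.+1 i w).
  rewrite -avgD -avgB; congr avg; apply/funext => i.
  have -> : ee t.+1 i w = ee t i w + gg t i w - hh t i w
    - C (uu t i w) (zeta t i w) by [].
  have -> : hh t.+1 i w = hh t i w + C (uu t i w) (zeta t i w) by [].
  by rewrite opprD addrA.
move: (xx t w) (avg _) (avg _) (avg _) => a b b' c.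
by apply/rowP => j; rewrite !mxE; ring.
Qed.

Let uuS t i w : uu t.+1 i w = (1 + eta) *: rr t i w
  + (- eta ^+ 2 *: ee t i w + (gg t.+1 i w - gg t i w)).
Proof.
rewrite {1}/uu eeS hhS.
move: (ee t i w) (rr t i w) (gg t.+1 i w) (gg t i w) => a b c e.
by apply/rowP => j; rewrite !mxE; ring.
Qed.

Let gradE x : grad (favg fi) x = avg (fun i => grad (fi i) x).
Proof. by rewrite grad_favg// => i; have [] := sfi i. Qed.

Let mg i : jmeas (g i) := proj1 Hg i.
Let mC : jmeas C := proj1 HC.
Let mxi t i : measurable_fun setT (xi t i) := proj1 Hiid t i.
Let mzeta t i : measurable_fun setT (zeta t i) := proj1 (proj2 Hiid) t i.

(** * Measurability of the iterates and their dependence on the noise *)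

Section measurability.
Context {dT : measure_display} {T : measurableType dT} (c : T -> O).
Context (t : nat).
Hypotheses (mxiT : forall s i, (s <= t)%N -> measurable_fun setT (xi s i \o c))
  (mzetaT : forall s i, (s < t)%N -> measurable_fun setT (zeta s i \o c)).

(** The map [c] will be the identity, from [O] with either its own or a smaller sigma-algebra, so
    that each measurability proof serves both. *)
Let mrun := measurable_run g C x0 gamma eta (fun s i => xi s i \o c)
  (fun s i => zeta s i \o c) mg mC t mxiT mzetaT.

Lemma measurable_iterate : mvec (fun w => xx t (c w)). Proof. by case: mrun. Qed.
Lemma measurable_error i : mvec (fun w => ee t i (c w)).
Proof. by case: mrun => _ + _ _; apply. Qed.
Lemma measurable_memory i : mvec (fun w => hh t i (c w)).
Proof. by case: mrun => _ _ + _; apply. Qed.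
Lemma measurable_virtual : mvec (fun w => vv t (c w)).
Proof.
apply: mvecB; first exact: measurable_iterate.
by do 2 apply: mvecZ; apply: mvec_sum; exact: measurable_error.
Qed.

Lemma measurable_grad_favg (V : T -> 'rV[R]_d) : mvec V -> mvec (fun w => grad (favg fi) (V w)).
Proof.
move=> mV; under eq_fun do rewrite gradE.
by apply: mvecZ; apply: mvec_sum => i; exact: (mvec_grad mu _ fi g sigma).
Qed.

Lemma measurable_oracle i : measurable_fun setT (xi t.+1 i \o c) -> mvec (fun w => gg t i (c w)).
Proof.
by move=> mx; exact: (mvec_jmeas (g i) _ (xi t.+1 i \o c) (mg i) measurable_iterate mx).
Qed.

Lemma measurable_noise i : measurable_fun setT (xi t.+1 i \o c) -> mvec (fun w => nz t i (c w)).
Proof.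
move=> mx; apply: mvecB; first exact: measurable_oracle.
by apply: (mvec_grad mu _ fi g sigma) => //; exact: measurable_iterate.
Qed.

Lemma measurable_residual i : measurable_fun setT (xi t.+1 i \o c) -> mvec (fun w => uu t i (c w)).
Proof.
move=> mx; apply: mvecB; last exact: measurable_memory.
by apply: mvecD; [apply: mvecZ; exact: measurable_error|exact: measurable_oracle].
Qed.

End measurability.

(* [Z] does not depend on the noise variable [xi t0 i0]. *)
Definition off_xi t0 i0 (Z : O -> 'rV[R]_d) : Prop :=
  forall G : set (set O),
    (forall t i, (t, i) != (t0, i0) ->
       measurable_fun [set: g_sigma_algebraType G] (xi t i)) ->
    (forall t i, measurable_fun [set: g_sigma_algebraType G] (zeta t i)) ->
    mvec (Z : g_sigma_algebraType G -> 'rV[R]_d).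

Let lt_key s j t i : (s <= t)%N -> (s, j) != (t.+1, i) :> nat * 'I_n.
Proof. by move=> st; rewrite xpair_eqE negb_and ltn_eqF// ltnS. Qed.

Lemma iterate_off_xi t i : off_xi t.+1 i (xx t).
Proof.
move=> G mx mz; apply: (@measurable_iterate _ (g_sigma_algebraType G) id) => s j st; last exact: mz.
by apply: mx; exact: lt_key.
Qed.

Lemma virtual_off_xi t i : off_xi t.+1 i (vv t).
Proof.
move=> G mx mz; apply: (@measurable_virtual _ (g_sigma_algebraType G) id) => s j st; last exact: mz.
by apply: mx; exact: lt_key.
Qed.

Lemma noise_off_xi t i j : j != i -> off_xi t.+1 i (nz t j).
Proof.
move=> ji G mx mz; apply: (@measurable_noise _ (g_sigma_algebraType G) id) => [s k st|s k _|].
- by apply: mx; exact: lt_key.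
- exact: mz.
- by apply: mx; rewrite xpair_eqE negb_and ji orbT.
Qed.

Lemma grad_off_xi t i V : off_xi t i V -> off_xi t i (fun w => grad (favg fi) (V w)).
Proof. by move=> oV G mx mz; apply: measurable_grad_favg; exact: oV. Qed.

Lemma noise_variance t i : l2 P (nz t i) /\ Ex P (fun w => sqn (nz t i w)) <= sigma ^+ 2.
Proof.
have [G [mx mz I]] := xi_tonelli P mu nu xi zeta Hiid t.+1 i.
apply: (oracle_variance P mu fi g sigma Hg G (xx t) (xi t.+1 i) i I) => //.
- exact: iterate_off_xi mx mz.
- by apply: (@measurable_iterate _ O id) => *; [exact: mxi|exact: mzeta].
Qed.

Lemma init_noise_variance i : let N := fun w => g i x0 (xi 0 i w) - grad (fi i) x0 in
  l2 P N /\ Ex P (fun w => sqn (N w)) <= sigma ^+ 2.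
Proof.
have [G [mx mz I]] := xi_tonelli P mu nu xi zeta Hiid 0 i.
by apply: (oracle_variance P mu fi g sigma Hg G (fun=> x0) (xi 0 i) i I) => //;
  exact: mvec_cst.
Qed.

Lemma noise_centred t i Z : off_xi t.+1 i Z -> l2 P Z ->
  Ex P (fun w => dot (Z w) (nz t i w)) = 0.
Proof.
move=> oZ lZ.
have [G [mx mz I]] := xi_tonelli P mu nu xi zeta Hiid t.+1 i.
apply: (oracle_centred P mu fi g sigma Hg G (xx t) (xi t.+1 i) i I) => //.
- exact: iterate_off_xi mx mz.
- by apply: (@measurable_iterate _ O id) => *; [exact: mxi|exact: mzeta].
- exact: oZ mx mz.
Qed.

Lemma residual_contract t i : l2 P (uu t i) ->
  l2 P (rr t i) /\
  Ex P (fun w => sqn (rr t i w)) <= (1 - delta) * Ex P (fun w => sqn (uu t i w)).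
Proof.
move=> lu.
(* The two noise families swap roles: now [zeta t i] is integrated out, and [uu t i] uses only
   earlier compressor noise. *)
have [G [mz mx I]] := xi_tonelli P nu mu zeta xi (iid_noiseC _ _ _ _ _ Hiid) t i.
apply: (compressor_contract P nu delta C G (uu t i) (zeta t i) HC I) => //.
apply: (@measurable_residual _ (g_sigma_algebraType G) id) => [s j _|s j st|]; try exact: mx.
by apply: mz; rewrite xpair_eqE negb_and ltn_eqF.
Qed.

(** A Lipschitz gradient grows at most linearly away from its value at 0. *)
Lemma l2_grad (f : 'rV[R]_d -> R) M V : 0 <= M -> smooth M f ->
  mvec (fun w => grad f (V w)) -> l2 P V -> l2 P (fun w => grad f (V w)).
Proof.
move=> M0 sM mV [_ IV]; apply: (l2_le P _ (fun w =>
  2 * (M ^+ 2 * sqn (V w)) + 2 * sqn (grad f 0))) => //.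
  by apply: int1D; [do 2 apply: int1Z|exact: int1_cst].
move=> w; rewrite -{1}(subrK (grad f 0) (grad f (V w))).
apply: (le_trans (sqnD2 _ _)); rewrite lerD2r ler_wpM2l//.
by rewrite -{2}[V w]subr0; exact: sqn_grad_lip.
Qed.

Lemma l2_avg (V : 'I_n -> O -> 'rV[R]_d) : (forall i, l2 P (V i)) ->
  l2 P (fun w => avg (fun i => V i w)).
Proof. by move=> lV; apply: l2Z; exact: l2_sum. Qed.

Let lgrad_i i V : l2 P V -> l2 P (fun w => grad (fi i) (V w)).
Proof.
move=> lV; apply: (l2_grad _ _ _ (Li0 i) (sfi i) _ lV).
by apply: (mvec_grad mu _ fi g sigma) => //; case: lV.
Qed.

Let lgrad V : l2 P V -> l2 P (fun w => grad (favg fi) (V w)).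
Proof.
by move=> lV; apply: (l2_grad _ _ _ L0 sf _ lV); apply: measurable_grad_favg; case: lV.
Qed.

Let lnz t i : l2 P (nz t i) := proj1 (noise_variance t i).

(** Only finiteness for each [t], with no uniform bound; it is what licenses linearity of [Ex] later
    on. *)
Lemma l2_state t : [/\ l2 P (xx t), forall i, l2 P (ee t i) & forall i, l2 P (hh t i)].
Proof.
elim: t => [|t [lx le lh]].
  split=> [|i|i]; [exact: l2_cst|exact: l2_cst|].
  have -> : hh 0 i = fun w => (g i x0 (xi 0 i w) - grad (fi i) x0) + grad (fi i) x0.
    by apply/funext => w; rewrite subrK.
  by apply: l2D; [exact: (proj1 (init_noise_variance i))|exact: l2_cst].
have lg i : l2 P (gg t i).
  have -> : gg t i = fun w => nz t i w + grad (fi i) (xx t w).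
    by apply/funext => w; rewrite subrK.
  by apply: l2D; [exact: lnz|exact: lgrad_i].
have lu i : l2 P (uu t i) by apply: l2B => //; apply: l2D => //; exact: l2Z.
have lr i := proj1 (residual_contract t i (lu i)).
have lh' i : l2 P (hh t.+1 i).
  under [hh _ _]funext do rewrite hhS.
  by apply: l2B => //; apply: l2D => //; exact: l2Z.
split=> //.
- under [xx _]funext do rewrite xxS.
  by apply: l2B => //; apply: l2Z; exact: l2_avg.
- move=> i; under [ee _ _]funext do rewrite eeS.
  by apply: l2D => //; exact: l2Z.
Qed.

Let lxx t : l2 P (xx t). Proof. by case: (l2_state t). Qed.
Let lee t i : l2 P (ee t i). Proof. by case: (l2_state t). Qed.
Let lhh t i : l2 P (hh t i). Proof. by case: (l2_state t). Qed.
Let lvv t : l2 P (vv t).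
Proof. by apply: l2B => //; apply: l2Z; exact: l2_avg. Qed.
Let lgg t i : l2 P (gg t i).
Proof.
have -> : gg t i = fun w => nz t i w + grad (fi i) (xx t w).
  by apply/funext => w; rewrite subrK.
by apply: l2D; [exact: lnz|exact: lgrad_i].
Qed.
Let luu t i : l2 P (uu t i).
Proof. by apply: l2B => //; apply: l2D => //; exact: l2Z. Qed.
Let lrr t i : l2 P (rr t i) := proj1 (residual_contract t i (luu t i)).

(** * Second-moment recursions *)

Let E2 (V : O -> 'rV[R]_d) : R := Ex P (fun w => sqn (V w)).
Let mean (a : 'I_n -> R) : R := n%:R^-1 * \sum_(i < n) a i.
Let EE t := mean (fun i => E2 (ee t i)).
Let UU t := mean (fun i => E2 (uu t i)).
Let NN t := E2 (fun w => grad (favg fi) (xx t w)).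
Let Lt2 := mean (fun i => Li i ^+ 2).

Let E2_ge0 V : 0 <= E2 V.
Proof. by apply: Ex_ge0 => w; exact: sqn_ge0. Qed.

Let ninv0 : 0 <= (n%:R^-1 : R). Proof. by rewrite invr_ge0. Qed.

Let mean_ge0 a : (forall i, 0 <= a i) -> 0 <= mean a.
Proof. by move=> a0; rewrite mulr_ge0// sumr_ge0. Qed.

Let mean_le a b : (forall i, a i <= b i) -> mean a <= mean b.
Proof. by move=> ab; rewrite ler_wpM2l// ler_sum. Qed.

Let meanD a b : mean (fun i => a i + b i) = mean a + mean b.
Proof. by rewrite /mean big_split mulrDr. Qed.

Let meanZ c a : mean (fun i => c * a i) = c * mean a.
Proof. by rewrite /mean -mulr_sumr mulrCA. Qed.

Let mean_cst (c : R) : mean (fun=> c) = c.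
Proof.
by rewrite /mean sumr_const card_ord -[c *+ n]mulr_natl mulrA mulVf ?mul1r// pnatr_eq0 -lt0n.
Qed.

Let isqn (V : O -> 'rV[R]_d) : l2 P V -> int1 P (fun w => sqn (V w)). Proof. by case. Qed.

Lemma error_step t : EE t.+1 <= (1 - eta) * EE t + eta^-1 * UU t.
Proof.
rewrite /EE /UU -!meanZ -meanD; apply: mean_le => i.
have H : E2 (ee t.+1 i) <= (1 - eta) * E2 (ee t i) + eta^-1 * E2 (rr t i).
  rewrite /E2 -!ExZ ?isqn// -ExD; [|by apply: int1Z; exact: isqn..].
  apply: Ex_le; [exact: isqn|by apply: int1D; apply: int1Z; exact: isqn|].
  by move=> w; rewrite eeS; exact: sqn_convex.
apply: (le_trans H); rewrite lerD2l ler_wpM2l ?invr_ge0 ?(ltW eta0)//.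
apply: (le_trans (proj2 (residual_contract t i (luu t i)))).
by apply: ler_piMl; [exact: E2_ge0|rewrite gerBl ltW].
Qed.

(** The step is -gamma times the mean of h^+ = eta e + g - r, and splitting the noise off g isolates
    the full gradient. Averaging of the noise is not exploited here, since this bound only feeds a
    higher-order term. *)
Lemma increment_bound t : E2 (fun w => xx t.+1 w - xx t w) <=
  gamma ^+ 2 * (2 * NN t + 4 * eta ^+ 2 * EE t + 8 * sigma ^+ 2 + 8 * UU t).
Proof.
pose k i w := eta *: ee t i w + (nz t i w - rr t i w).
have lk i : l2 P (k i) by apply: l2D; [exact: l2Z|exact: l2B].
have lG : l2 P (fun w => grad (favg fi) (xx t w)) by exact: lgrad.
have Hw w : sqn (xx t.+1 w - xx t w) <= gamma ^+ 2 *
    (2 * sqn (grad (favg fi) (xx t w)) + 2 * (n%:R^-1 * \sum_(i < n) sqn (k i w))).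
  rewrite (_ : _ - _ = - gamma *: avg (fun i => hh t.+1 i w)); last first.
    by rewrite xxS addrAC subrr add0r scaleNr.
  rewrite sqnZ sqrrN ler_wpM2l ?sqr_ge0//.
  have -> : avg (fun i => hh t.+1 i w) = grad (favg fi) (xx t w) + avg (fun i => k i w).
    rewrite gradE -avgD; congr avg; apply/funext => i; rewrite hhS /k /nz.
    move: (gg t i w) (grad _ _) (ee t i w) (rr t i w) => a b c e.
    by apply/rowP => j; rewrite !mxE; ring.
  apply: (le_trans (sqnD2 _ _)); rewrite lerD2l ler_wpM2l//.
  exact: sqn_mean.
have ik i : int1 P (fun w => sqn (k i w)) by exact: isqn.
have H : E2 (fun w => xx t.+1 w - xx t w)
    <= gamma ^+ 2 * (2 * NN t + 2 * mean (fun i => E2 (k i))).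
  rewrite /NN /mean /E2 -Ex_sum// -!ExZ; last first.
  - exact: isqn.
  - exact: int1_sum.
  - by apply: int1Z; exact: int1_sum.
  rewrite -ExD; last first.
  - by do 2 apply: int1Z; exact: int1_sum.
  - by apply: int1Z; exact: isqn.
  rewrite -ExZ; last first.
    apply: int1D; first by apply: int1Z; exact: isqn.
    by do 2 apply: int1Z; exact: int1_sum.
  apply: Ex_le => //; first by apply: isqn; exact: l2B.
  apply: int1Z; apply: int1D; first by apply: int1Z; exact: isqn.
  by do 2 apply: int1Z; exact: int1_sum.
apply: (le_trans H); rewrite ler_wpM2l ?sqr_ge0//.
rewrite -!addrA lerD2l.
have Hk : mean (fun i => E2 (k i)) <= mean (fun i => 2 * eta ^+ 2 * E2 (ee t i)
    + 4 * sigma ^+ 2 + 4 * E2 (uu t i)).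
  apply: mean_le => i.
  have h1 : E2 (k i) <= 2 * eta ^+ 2 * E2 (ee t i) + (4 * E2 (nz t i) + 4 * E2 (rr t i)).
    have i1 : int1 P (fun w => 2 * eta ^+ 2 * sqn (ee t i w)) by apply: int1Z; exact: isqn.
    have i2 : int1 P (fun w => 4 * sqn (nz t i w)) by apply: int1Z; exact: isqn.
    have i3 : int1 P (fun w => 4 * sqn (rr t i w)) by apply: int1Z; exact: isqn.
    rewrite /E2 -!ExZ ?isqn// -!ExD//; last exact: int1D.
    apply: Ex_le => //; first by apply: int1D => //; exact: int1D.
    by move=> w; exact: sqn_scale_sub.
  have h2 := proj2 (noise_variance t i).
  have h3 := proj2 (residual_contract t i (luu t i)).
  have h4 := mulr_ge0 (ltW delta0) (E2_ge0 (uu t i)).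
  move: h1 h2 h3 h4; rewrite -/(E2 (nz t i)) -/(E2 (rr t i)) -/(E2 (uu t i)).
  move: (E2 (k i)) (E2 (ee t i)) (E2 (nz t i)) (E2 (rr t i)) (E2 (uu t i)) (eta ^+ 2) (sigma ^+ 2).
  by move=> a b c e f p q; lra.
rewrite !meanD !meanZ mean_cst -/(EE t) -/(UU t) in Hk.
rewrite (_ : 4 * eta ^+ 2 * EE t + _
  = 2 * (2 * eta ^+ 2 * EE t + 4 * sigma ^+ 2 + 4 * UU t)); last by ring.
by rewrite ler_wpM2l.
Qed.

(** The change of the stochastic gradient splits into two noises and a gradient difference; the
    latter is controlled client by client, so the mean of the [Li i ^+ 2] appears rather than
    [L]. *)
Lemma residual_step t : UU t.+1 <= (1 - delta / 2) * UU t
  + 9 / delta * (2 * (delta / 16) ^+ 4 * EE t + 16 * sigma ^+ 2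
     + 4 * (Lt2 * (gamma ^+ 2 *
         (2 * NN t + 4 * eta ^+ 2 * EE t + 8 * sigma ^+ 2 + 8 * UU t)))).
Proof.
pose D := E2 (fun w => xx t.+1 w - xx t w).
have H i : E2 (uu t.+1 i) <= (1 - delta / 2) * E2 (uu t i)
    + 9 / delta * (2 * (delta / 16) ^+ 4 * E2 (ee t i) + 16 * sigma ^+ 2
      + 4 * (Li i ^+ 2 * D)).
  apply: le_trans; last first.
    apply: (residual_step_scalar delta eta (E2 (rr t i)) (E2 (uu t i)) (E2 (ee t i))
      (E2 (nz t i)) (E2 (nz t.+1 i)) D (Li i) (sigma ^+ 2)) => //.
    - exact: E2_ge0.
    - exact: sqr_ge0.
    - exact: (proj2 (residual_contract t i (luu t i))).
    - exact: (proj2 (noise_variance t i)).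
    - exact: (proj2 (noise_variance t.+1 i)).
  have lD : l2 P (fun w => xx t.+1 w - xx t w) by exact: l2B.
  apply: (@le_trans _ _ (Ex P (fun w =>
      (1 + delta / 8) * ((1 + eta) ^+ 2 * sqn (rr t i w)) + (1 + (delta / 8)^-1)
      * (2 * (eta ^+ 4 * sqn (ee t i w)) + 2 * (4 * sqn (nz t.+1 i w) + 4 * sqn (nz t i w)
      + 2 * (Li i ^+ 2 * sqn (xx t.+1 w - xx t w))))))).
    apply: Ex_le; [exact: isqn|by apply: int1_combination; exact: isqn|].
    move=> w; rewrite uuS.
    have d8 : 0 < delta / 8 by rewrite divr_gt0.
    apply: (le_trans (young_sqn _ _ _ d8)); rewrite sqnZ lerD2l ler_wpM2l//.
      by rewrite addr_ge0// invr_ge0 ltW.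
    apply: (le_trans (sqnD2 _ _)); rewrite sqnZ sqrrN -exprM lerD2l ler_wpM2l//.
    have -> : gg t.+1 i w - gg t i w = (nz t.+1 i w - nz t i w)
        + (grad (fi i) (xx t.+1 w) - grad (fi i) (xx t w)).
      rewrite /nz; move: (gg t.+1 i w) (gg t i w) (grad _ _) (grad _ _) => a b c e.
      by apply/rowP => j; rewrite !mxE; ring.
    apply: (le_trans (sqnD2 _ _)); apply: lerD.
      exact: sqnB2_double.
    by rewrite ler_wpM2l// sqn_grad_lip.
  by rewrite Ex_combination//; exact: isqn.
apply: (le_trans (mean_le _ _ H)).
rewrite meanD !meanZ !meanD !meanZ mean_cst -/(EE t) -/(UU t).
rewrite (_ : mean (fun i => Li i ^+ 2 * D) = Lt2 * D); last first.
  by rewrite /mean -mulr_suml mulrA.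
rewrite lerD2l ler_wpM2l ?divr_ge0 ?(ltW delta0)// lerD2l ler_wpM2l//.
rewrite ler_wpM2l//; first by apply: mean_ge0 => i; exact: sqr_ge0.
exact: increment_bound.
Qed.

(** As e_0 = 0, the vector u_0 is the difference of two oracle calls at x_0, whose common mean
    cancels. *)
Lemma residual_init : UU 0 <= 4 * sigma ^+ 2.
Proof.
rewrite -[leRHS](mean_cst); apply: mean_le => i.
have [lN EN] := init_noise_variance i.
pose N w := g i x0 (xi 0 i w) - grad (fi i) x0.
have i1 : int1 P (fun w => 2 * sqn (nz 0 i w)) by apply: int1Z; exact: isqn.
have i2 : int1 P (fun w => 2 * sqn (N w)) by apply: int1Z; exact: isqn.
apply: (@le_trans _ _ (Ex P (fun w => 2 * sqn (nz 0 i w) + 2 * sqn (N w)))).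
  apply: Ex_le; [exact: isqn|exact: int1D|].
  move=> w; have -> : uu 0 i w = nz 0 i w - N w; last exact: sqnB2.
  have -> : uu 0 i w = eta *: 0 + gg 0 i w - g i x0 (xi 0 i w) by [].
  have -> : nz 0 i w = gg 0 i w - grad (fi i) x0 by [].
  by rewrite scaler0 add0r /N opprB addrA subrK.
rewrite ExD// !ExZ ?isqn//.
have := proj2 (noise_variance 0 i).
by move: EN; rewrite -/(E2 N) -/(E2 (nz 0 i));
  move: (E2 N) (E2 (nz 0 i)) (sigma ^+ 2) => a b c; lra.
Qed.

(** * Averaged noise and descent along the virtual iterates *)

Let nb t w := avg (fun i => nz t i w).
Let lnb t : l2 P (nb t). Proof. exact: l2_avg. Qed.

Lemma mean_noise_variance t : E2 (nb t) <= sigma ^+ 2 / n%:R.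
Proof.
have int_dot i j : int1 P (fun w => dot (nz t i w) (nz t j w)) by exact: int1_dot.
have E w : sqn (nb t w) = n%:R ^- 2 *
    \sum_(j < n) \sum_(i < n) dot (nz t i w) (nz t j w).
  by rewrite /nb /avg sqnZ exprVn sqn_sum.
have -> : E2 (nb t) = n%:R ^- 2 *
    \sum_(j < n) \sum_(i < n) Ex P (fun w => dot (nz t i w) (nz t j w)).
  rewrite /E2; under [X in Ex P X]eq_fun do rewrite E.
  rewrite ExZ; last by apply: int1_sum => j; exact: int1_sum.
  rewrite Ex_sum; last by move=> j; exact: int1_sum.
  by congr (_ * _); apply: eq_bigr => j _; rewrite Ex_sum.
have -> : \sum_(j < n) \sum_(i < n) Ex P (fun w => dot (nz t i w) (nz t j w))
    = \sum_(j < n) E2 (nz t j).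
  apply: eq_bigr => j _; rewrite (bigD1 j)//= big1 ?addr0.
    by rewrite /E2; congr Ex; apply/funext => w; rewrite dotvv.
  (* Noises of distinct clients are uncorrelated: that of client [j] does not involve
     [xi t.+1 i]. *)
  by move=> i ij; apply: noise_centred => //; exact: noise_off_xi.
have nR : (n%:R : R) != 0 by rewrite pnatr_eq0 -lt0n.
apply: (@le_trans _ _ (n%:R ^- 2 * \sum_(j < n) sigma ^+ 2)).
  rewrite ler_wpM2l ?invr_ge0 ?sqr_ge0//; apply: ler_sum => j _.
  exact: (proj2 (noise_variance t j)).
rewrite sumr_const card_ord -[sigma ^+ 2 *+ n]mulr_natl le_eqVlt; apply/orP; left.
by apply/eqP; field.
Qed.

Lemma mean_noise_centred t Z : (forall i, off_xi t.+1 i Z) -> l2 P Z ->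
  Ex P (fun w => dot (Z w) (nb t w)) = 0.
Proof.
move=> oZ lZ; have iz i : int1 P (fun w => dot (Z w) (nz t i w)) by exact: int1_dot.
under [X in Ex P X]eq_fun do rewrite /nb /avg dotZr dot_sumr.
rewrite ExZ ?Ex_sum//; last exact: int1_sum.
by rewrite big1 ?mulr0// => i _; apply: noise_centred => //; exact: oZ.
Qed.

Let gx t w := grad (favg fi) (xx t w).
Let gv t w := grad (favg fi) (vv t w).
Let lgx t : l2 P (gx t). Proof. exact: lgrad. Qed.
Let lgv t : l2 P (gv t). Proof. exact: lgrad. Qed.

Let bound t w := gamma * 2^-1 * ((gamma * L) ^+ 2 * mean (fun i => sqn (ee t i w)))
  + ((- gamma / 2 + L * gamma ^+ 2) * sqn (gx t w) + (- gamma * dot (gv t w) (nb t w)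
  + (2 * L * gamma ^+ 2 * dot (gx t w) (nb t w) + L * gamma ^+ 2 * sqn (nb t w)))).

Let imean t : int1 P (fun w => (gamma * L) ^+ 2 * mean (fun i => sqn (ee t i w))).
Proof. by do 2 apply: int1Z; apply: int1_sum => i; exact: isqn. Qed.

Let igx t : int1 P (fun w => sqn (gx t w)) := isqn (gx t) (lgx t).
Let igvnb t := int1_dot P _ _ (lgv t) (lnb t).
Let igxnb t := int1_dot P _ _ (lgx t) (lnb t).
Let inb t : int1 P (fun w => sqn (nb t w)) := isqn (nb t) (lnb t).

Let ibound t : int1 P (bound t).
Proof.
exact: (int1_linear5 P _ _ _ _ _ (gamma * 2^-1) (- gamma / 2 + L * gamma ^+ 2)
  (- gamma) (2 * L * gamma ^+ 2) (L * gamma ^+ 2)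
  (imean t) (igx t) (igvnb t) (igxnb t) (inb t)).
Qed.

Let Ex_bound t : Ex P (bound t) <=
  gamma * (2^-1 * (gamma * L) ^+ 2 * EE t - 2^-1 * NN t)
  + L * gamma ^+ 2 * (NN t + sigma ^+ 2 / n%:R).
Proof.
have z1 : Ex P (fun w => dot (gv t w) (nb t w)) = 0.
  by apply: (mean_noise_centred t (gv t)) (lgv t) => i; apply: grad_off_xi; exact: virtual_off_xi.
have z2 : Ex P (fun w => dot (gx t w) (nb t w)) = 0.
  by apply: (mean_noise_centred t (gx t)) (lgx t) => i; apply: grad_off_xi; exact: iterate_off_xi.
have iS : int1 P (fun w => \sum_(i < n) sqn (ee t i w)).
  by apply: int1_sum => i; exact: isqn.
have z3 : Ex P (fun w => (gamma * L) ^+ 2 * mean (fun i => sqn (ee t i w)))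
    = (gamma * L) ^+ 2 * EE t.
  rewrite (ExZ P ((gamma * L) ^+ 2) _ (int1Z P n%:R^-1 _ iS)) (ExZ P n%:R^-1 _ iS).
  by rewrite (Ex_sum P _ _ (fun i => isqn _ (lee t i))).
have -> := Ex_linear5 P _ _ _ _ _ (gamma * 2^-1) (- gamma / 2 + L * gamma ^+ 2)
  (- gamma) (2 * L * gamma ^+ 2) (L * gamma ^+ 2)
  (imean t) (igx t) (igvnb t) (igxnb t) (inb t)
  _ (NN t) _ _ (E2 (nb t)) z3 erefl z1 z2 erefl.
have Lg : 0 <= L * gamma ^+ 2 by rewrite mulr_ge0 ?sqr_ge0.
exact: descent_value (ler_wpM2l Lg (mean_noise_variance t)).
Qed.

Let descent t w : favg fi (vv t.+1 w) <= favg fi (vv t w) + bound t w.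
Proof.
rewrite vvS; apply: (le_trans (smooth_descent L _ _ _ L0 sf)).
rewrite -addrA lerD2l.
have -> : avg (fun i => gg t i w) = gx t w + nb t w.
  rewrite /gx gradE /nb -avgD; congr avg; apply/funext => i.
  by rewrite /nz addrC subrK.
apply: descent_term; first exact: ltW.
apply: (le_trans (sqn_grad_lip L _ _ _ L0 sf)).
have -> : vv t w - xx t w = - gamma *: avg (fun i => ee t i w).
  by rewrite /vv addrAC subrr add0r scaleNr.
rewrite sqnZ sqrrN exprMn [X in _ <= X * _]mulrC -[leRHS]mulrA.
apply: ler_wpM2l; first exact: sqr_ge0.
by apply: ler_wpM2l; [exact: sqr_ge0|exact: sqn_mean].
Qed.

(** The descent is telescoped pointwise and [fmin] inserted before expectations are taken, so
    integrability of f at the virtual iterates never arises. *)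
Lemma descent_sum (fmin : R) T : (forall x, fmin <= favg fi x) ->
  0 <= favg fi x0 - fmin + \sum_(t < T)
    (gamma * (2^-1 * (gamma * L) ^+ 2 * EE t - 2^-1 * NN t)
     + L * gamma ^+ 2 * (NN t + sigma ^+ 2 / n%:R)).
Proof.
move=> fm.
have vv0 w : vv 0 w = x0.
  have -> : vv 0 w = x0 - gamma *: avg (fun=> 0) by [].
  by rewrite /avg big1// !scaler0 subr0.
have D w : favg fi (vv T w) <= favg fi x0 + \sum_(t < T) bound t w.
  elim: T => [|T IH]; first by rewrite big_ord0 addr0 vv0.
  rewrite big_ord_recr/= addrA; apply: (le_trans (descent T w)).
  by rewrite lerD2r.
have : Ex P (fun=> fmin - favg fi x0) <= Ex P (fun w => \sum_(t < T) bound t w).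
  apply: Ex_le; [exact: int1_cst|by apply: int1_sum|].
  by move=> w; rewrite lerBlDl (le_trans (fm (vv T w))).
rewrite Ex_cst Ex_sum//.
have : \sum_(t < T) Ex P (bound t) <= \sum_(t < T)
    (gamma * (2^-1 * (gamma * L) ^+ 2 * EE t - 2^-1 * NN t)
     + L * gamma ^+ 2 * (NN t + sigma ^+ 2 / n%:R)) by apply: ler_sum.
move=> ab fa; have := le_trans fa ab.
by rewrite lerBlDl addrAC subr_ge0.
Qed.

Lemma econtrol_sum_bound (Lt fmin : R) T : (forall x, fmin <= favg fi x) ->
  L <= Lt -> Lt ^+ 2 = n%:R^-1 * \sum_(i < n) Li i ^+ 2 -> gamma * Lt <= delta / 100 ->
  gamma / 8 * \sum_(t < T.+1) Ex P (fun w => sqn (grad (favg fi) (xx t w)))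
  <= favg fi x0 - fmin + T.+1%:R * (L * gamma ^+ 2 * (sigma ^+ 2 / n%:R)
       + 400 ^+ 2 * (gamma * (gamma * L / delta ^+ 2) ^+ 2) * sigma ^+ 2).
Proof.
move=> fm LLt Lt2E gLt.
have etaE : eta = delta / 16 by rewrite /eta mulrC.
apply: (lyapunov_sum delta gamma L Lt (sigma ^+ 2) (sigma ^+ 2 / n%:R)
  (favg fi x0 - fmin) EE UU NN) => //.
- exact: sqr_ge0.
- by move=> t; apply: mean_ge0 => i; exact: E2_ge0.
- by move=> t; apply: mean_ge0 => i; exact: E2_ge0.
- by move=> t; exact: E2_ge0.
- rewrite /EE /mean big1 ?mulr0// => i _.
  by rewrite /E2 (_ : (fun w => _) = (fun=> 0)) ?Ex_cst//; apply/funext => w; exact: sqn0.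
- exact: residual_init.
- by move=> t; have := error_step t; rewrite etaE invf_div.
- have S (a b z : R) : 4 * (a * b) ^+ 2 * z = 4 * (b ^+ 2 * (a ^+ 2 * z)) by ring.
  by move=> t; rewrite S Lt2E -{2}etaE; exact: residual_step.
- by move=> M; exact: descent_sum.
Qed.

Lemma econtrol_integral t :
  (\int[P]_w (sqn (grad (favg fi) (econtrol_x g C x0 gamma (16^-1 * delta)
     (fun k i => xi k i w) (fun k i => zeta k i w) t)))%:E
   = (Ex P (fun w => sqn (grad (favg fi) (xx t w))))%:E)%E.
Proof. exact: (int1E P _ (isqn _ (lgx t))). Qed.

End econtrol.

(** * Choice of the step size and conclusion *)

Lemma smooth_favg {R : realType} {d n : nat} (fi : 'I_n -> 'rV[R]_d -> R)
    (Li : 'I_n -> R) : (forall i, 0 <= Li i) -> (forall i, smooth (Li i) (fi i)) ->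
  (forall x, differentiable (favg fi) x) ->
  smooth (Num.sqrt (n%:R^-1 * \sum_(i < n) Li i ^+ 2)) (favg fi).
Proof.
move=> Li0 sfi df; split=> // x y.
have dfi z i : differentiable (fi i) z by have [] := sfi i.
have M0 : 0 <= n%:R^-1 * \sum_(i < n) Li i ^+ 2.
  by rewrite mulr_ge0 ?invr_ge0// sumr_ge0// => i _; exact: sqr_ge0.
rewrite /enorm -sqrtrM// ler_sqrt; last by rewrite mulr_ge0// sqn_ge0.
rewrite !grad_favg// -scalerBr -sumrB.
apply: (le_trans (sqn_mean _ _)); rewrite -mulrA mulr_suml ler_wpM2l ?invr_ge0//.
by apply: ler_sum => i _; exact: sqn_grad_lip.
Qed.

Lemma smooth_minr {R : realType} {d : nat} (f : 'rV[R]_d -> R) (L1 L2 : R) :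
  smooth L1 f -> smooth L2 f -> smooth (Num.min L1 L2) f.
Proof. by move=> s1 s2; rewrite minEle; case: ifP. Qed.

(* When [s0 = 0] any positive [s] is allowed; a small one makes [T = 0]. *)
Lemma horizon_choice {R : realType} (eps F0 s0 : R) : 0 < eps -> 0 <= F0 -> 0 <= s0 ->
  exists (s : R) (T : nat), [/\ 0 < s, s0 <= s, 32 * F0 * s / eps <= T.+1%:R &
    T%:R <= 32 * F0 * s0 / eps].
Proof.
move=> e0 F00 s00.
have F1 : 0 < 32 * F0 + 1 by rewrite ltr_wpDl// mulr_ge0.
have [->|sn0] := eqVneq s0 0.
  exists (eps / (32 * F0 + 1)), 0; split; rewrite ?divr_ge0 ?divr_gt0 ?(ltW F1) ?(ltW e0)//.
    have -> : 32 * F0 * (eps / (32 * F0 + 1)) / eps = 32 * F0 / (32 * F0 + 1).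
      by field; rewrite !gt_eqF.
    by rewrite ler_pdivrMr// mul1r lerDl.
  by rewrite mulr0 ?mul0r.
have A0 : 0 <= 32 * F0 * s0 / eps by rewrite divr_ge0 ?mulr_ge0// ltW.
have /andP[T1 T2] := truncn_itv A0.
by exists s0, (Num.trunc (32 * F0 * s0 / eps)); split=> //;
  [rewrite lt_neqAle eq_sym sn0|exact: ltW].
Qed.

Theorem theorem4 :
  forall R : realType,
  exists c Cst K : R, 0 < c /\ 0 < Cst /\ 0 < K /\
  forall (d n : nat) (fi : 'I_n -> 'rV[R]_d -> R) (L : R) (Li : 'I_n -> R)
         (sigma delta eps : R) (x0 : 'rV[R]_d),
    (0 < n)%N -> 0 < delta -> delta <= 1 -> 0 < eps -> 0 <= sigma ->
    0 <= L -> (forall i, 0 <= Li i) ->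
    (exists m : R, forall x, m <= favg fi x) ->
    smooth L (favg fi) -> (forall i, smooth (Li i) (fi i)) ->
    let Ltil := Num.sqrt (n%:R^-1 * \sum_(i < n) Li i ^+ 2) in
    let F0 := favg fi x0 - inf (range (favg fi)) in
    let eta := c * delta in
    exists (gamma : R) (T : nat),
      0 < gamma /\ gamma * Ltil <= Cst * delta /\
      T%:R <= K * (L * F0 * sigma ^+ 2 / (n%:R * eps ^+ 2)
                   + L * F0 * sigma / (delta ^+ 2 * (eps * Num.sqrt eps))
                   + Ltil * F0 / (delta * eps)) /\
      forall (dX : measure_display) (X : measurableType dX) (mu : probability X R)
             (dY : measure_display) (Y : measurableType dY) (nu : probability Y R)
             (g : 'I_n -> 'rV[R]_d -> X -> 'rV[R]_d) (C : 'rV[R]_d -> Y -> 'rV[R]_d)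
             (dO : measure_display) (O : measurableType dO) (P : probability O R)
             (xi : nat -> 'I_n -> O -> X) (zeta : nat -> 'I_n -> O -> Y),
        stoch_oracle mu fi g sigma ->
        compressor nu delta C ->
        iid_noise P mu nu xi zeta ->
        ((T.+1%:R)^-1%:E *
         \sum_(t < T.+1)
            \int[P]_w (sqn (grad (favg fi)
               (econtrol_x g C x0 gamma eta
                  (fun k i => xi k i w) (fun k i => zeta k i w) t)))%:E
         <= eps%:E)%E.
Proof.
(* The 32 is the factor of F0 in the horizon, and 23 * 100 is the largest of the three step-size
   constants 100, 32 and 2300. *)
move=> R; exists 16^-1, 100^-1, (32 * (23 * 100)).
split; first by rewrite invr_gt0.
split; first by rewrite invr_gt0.
split; first by rewrite !mulr_gt0.
move=> d n fi L Li sigma delta eps x0 n0 delta0 delta1 eps0 sigma0 L0 Li0 [m fm] sf sfi.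
move=> Ltil F0 eta.
have nR0 : 0 < (n%:R : R) by rewrite ltr0n.
have M0 : 0 <= n%:R^-1 * \sum_(i < n) Li i ^+ 2.
  by rewrite mulr_ge0 ?invr_ge0 ?(ltW nR0)// sumr_ge0// => i _; exact: sqr_ge0.
have Ltil0 : 0 <= Ltil by exact: sqrtr_ge0.
have Ltil2 : Ltil ^+ 2 = n%:R^-1 * \sum_(i < n) Li i ^+ 2 by exact: sqr_sqrtr.
pose L1 := Num.min L Ltil.
have sL1 : smooth L1 (favg fi).
  by apply: smooth_minr => //; apply: smooth_favg => //; case: sf.
have L10 : 0 <= L1 by rewrite le_min L0.
have L1L : L1 <= L by rewrite ge_min lexx.
have L1Lt : L1 <= Ltil by rewrite ge_min lexx orbT.
have finf x : inf (range (favg fi)) <= favg fi x.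
  by apply: ge_inf; [exists m => _ [z _ <-]|exists x].
have F00 : 0 <= F0 by rewrite subr_ge0.
have F0E : F0 = favg fi x0 - inf (range (favg fi)) by [].
clearbody Ltil F0 L1.
have se0 : 0 < Num.sqrt eps by rewrite sqrtr_gt0.
(* Each of [t1], [t2], [t3] is a lower bound required of 1/gamma; they serve the Lyapunov argument,
   the averaged noise and the compression noise. Using their sum makes the horizon a sum of three
   terms. *)
pose t1 := 100 * (Ltil / delta).
pose t2 := 32 * (L1 * sigma ^+ 2 / (n%:R * eps)).
pose t3 := 23 * 100 * (L1 * sigma / (delta ^+ 2 * Num.sqrt eps)).
have t10 : 0 <= t1 by rewrite mulr_ge0 ?divr_ge0 ?(ltW delta0).
have t20 : 0 <= t2.
  by rewrite mulr_ge0 ?divr_ge0 ?mulr_ge0 ?exprn_ge0 ?(ltW nR0) ?(ltW eps0).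
have t30 : 0 <= t3.
  apply: mulr_ge0; first by rewrite mulr_ge0.
  by rewrite divr_ge0 ?mulr_ge0 ?exprn_ge0 ?(ltW delta0) ?(ltW se0).
have t0 : 0 <= t1 + t2 + t3 by rewrite !addr_ge0.
have [s [T [s0 ts HT TK]]] := horizon_choice _ _ _ eps0 F00 t0.
have small t : t <= s -> s^-1 * t <= 1 by move=> ?; rewrite ler_pdivrMl// mulr1.
exists s^-1, T; split; first by rewrite invr_gt0.
have gLt : s^-1 * Ltil <= delta / 100.
  have : s^-1 * t1 <= 1 by apply: small; apply: le_trans ts; lra.
  have -> : s^-1 * t1 = (s^-1 * Ltil) / (delta / 100).
    by rewrite /t1; field; rewrite !gt_eqF.
  by rewrite ler_pdivrMr ?divr_gt0// mul1r.
split; first by rewrite mulrC [_ * delta]mulrC mulrC.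
split.
  apply: (le_trans TK).
  have -> : 32 * F0 * (t1 + t2 + t3) / eps =
      32 * (100 * (Ltil * F0 / (delta * eps)) + 32 * (L1 * F0 * sigma ^+ 2 / (n%:R * eps ^+ 2))
        + 23 * 100 * (L1 * F0 * sigma / (delta ^+ 2 * (eps * Num.sqrt eps)))).
    by rewrite /t1 /t2 /t3; field; rewrite !gt_eqF.
  have hb : L1 * F0 * sigma ^+ 2 / (n%:R * eps ^+ 2)
      <= L * F0 * sigma ^+ 2 / (n%:R * eps ^+ 2).
    rewrite ler_wpM2r ?invr_ge0 ?mulr_ge0 ?exprn_ge0 ?(ltW nR0) ?(ltW eps0)//.
    by rewrite ler_wpM2r ?sqr_ge0// ler_wpM2r.
  have hc : L1 * F0 * sigma / (delta ^+ 2 * (eps * Num.sqrt eps))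
      <= L * F0 * sigma / (delta ^+ 2 * (eps * Num.sqrt eps)).
    rewrite ler_wpM2r ?invr_ge0 ?mulr_ge0 ?exprn_ge0 ?(ltW delta0) ?(ltW eps0) ?(ltW se0)//.
    by rewrite ler_wpM2r// ler_wpM2r.
  have ha : 0 <= Ltil * F0 / (delta * eps).
    by rewrite divr_ge0 ?mulr_ge0 ?(ltW delta0) ?(ltW eps0).
  have hb0 : 0 <= L1 * F0 * sigma ^+ 2 / (n%:R * eps ^+ 2).
    by rewrite divr_ge0 ?mulr_ge0 ?exprn_ge0 ?(ltW nR0) ?(ltW eps0).
  by move: hb hc ha hb0; clear; move: (_ / _) (_ / _) (_ / _) (_ / _) (_ / _) => *; lra.
move=> dX X mu dY Y nu g C dO O P xi zeta Hg HC Hiid.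
have g0 : 0 < s^-1 by rewrite invr_gt0.
under eq_bigr do rewrite (econtrol_integral P mu nu fi L1 Li sigma delta s^-1 x0 g C
  xi zeta L10 Li0 sL1 sfi Hg HC Hiid).
rewrite sumEFin -EFinM lee_fin.
apply: (stepsize_bound delta s^-1 L1 (sigma ^+ 2) eps n%:R F0 _ T sigma) => //.
- by apply: small; apply: le_trans ts; rewrite -/t2; lra.
- by apply: small; apply: le_trans ts; rewrite -/t3; lra.
- by rewrite invfM invrK mulrA.
- rewrite F0E.
  exact: (econtrol_sum_bound P mu nu fi L1 Li sigma delta s^-1 x0 g C xi zeta n0
    delta0 delta1 g0 L10 Li0 sL1 sfi Hg HC Hiid Ltil).
Qed.
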